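(* Let $\varphi$ be an Orlicz function. (Function case) Let $w$ be a weight function on $I=[0,\gamma)$, $0<\gamma\le\infty$. For any singular functional $S$ on $\Lambda_{\varphi,w}$ (equipped with the Luxemburg norm or the Orlicz norm), $$\|S\|_{(\Lambda_{\varphi,w})^*}=\|S\|_{(\Lambda^0_{\varphi,w})^*}=\sup\{S(f):\rho_{\varphi,w}(f)<\infty\}=\sup\Big\{\frac{S(f)}{\theta(f)}:f\in\Lambda_{\varphi,w}\setminus(\Lambda_{\varphi,w})_a\Big\}.$$ (Sequence case) Let $w=(w(i))$ be a weight sequence. For any singular functional $S$ on $\lambda_{\varphi,w}$ (equipped with either norm), $$\|S\|_{(\lambda_{\varphi,w})^*}=\|S\|_{(\lambda^0_{\varphi,w})^*}=\sup\{S(x):\alpha_{\varphi,w}(x)<\infty\}=\sup\Big\{\frac{S(x)}{\theta(x)}:x\in\lambda_{\varphi,w}\setminus(\lambda_{\varphi,w})_a\Big\}.$$ (The supremum of the empty set is read as $0$.)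
   Context: An Orlicz function is a convex function $\varphi:[0,\infty)\to[0,\infty)$ with $\varphi(0)=0$ and $\varphi(t)>0$ for $t>0$. Its complementary function is $\varphi_*(v)=\sup\{uv-\varphi(u):u\ge0\}$, $v\ge0$. Function case. $I=[0,\gamma)$, $0<\gamma\le\infty$, with Lebesgue measure $m$; $L^0$ is the set of (classes of) Lebesgue measurable functions $f:I\to\mathbb R$. For $f\in L^0$, $d_f(\lambda)=m\{t\in I:|f(t)|>\lambda\}$ for $\lambda>0$, and $f^*(t)=\inf\{\lambda>0:d_f(\lambda)\le t\}$, $t\in[0,\gamma)$. A weight function $w:I\to(0,\infty)$ is decreasing (non-increasing) and locally integrable, with $W(t)=\int_0^tw<\infty$ for $t\in I$, and $W(\infty)=\infty$ if $\gamma=\infty$. For $f\in L^0$ put $\rho_{\varphi,w}(f)=\int_0^\gamma\varphi(f^*(t))w(t)\,dt$. The Orlicz-Lorentz function space is the set of all $f\in L^0$ with $\rho_{\varphi,w}(\lambda f)<\infty$ for some $\lambda>0$. It is denoted $\Lambda_{\varphi,w}$ when equipped with the Luxemburg norm $\|f\|=\inf\{\epsilon>0:\rho_{\varphi,w}(f/\epsilon)\le1\}$, and $\Lambda^0_{\varphi,w}$ when equipped with the Orlicz norm $\|f\|^0=\sup\{\int_If^*g^*w:g\in L^0,\ \rho_{\varphi_*,w}(g)\le1\}$; these norms are equivalent. Put $\theta(f)=\inf\{\lambda>0:\rho_{\varphi,w}(f/\lambda)<\infty\}$. Sequence case. For a real sequence $x=(x(i))$ use counting measure on $\mathbb N$ to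 define $d_x$, and $x^*(i)=\inf\{\lambda>0:d_x(\lambda)<i\}$. A weight sequence $w=(w(i))$ is positive and decreasing (non-increasing) with $\sum_{i=1}^\infty w(i)=\infty$. Put $\alpha_{\varphi,w}(x)=\sum_{i=1}^\infty\varphi(x^*(i))w(i)$. The Orlicz-Lorentz sequence space is the set of real sequences $x$ with $\alpha_{\varphi,w}(\eta x)<\infty$ for some $\eta>0$; it is denoted $\lambda_{\varphi,w}$ with the Luxemburg norm $\|x\|=\inf\{\epsilon>0:\alpha_{\varphi,w}(x/\epsilon)\le1\}$ and $\lambda^0_{\varphi,w}$ with the Orlicz norm $\|x\|^0=\sup\{\sum_{i}x^*(i)y^*(i)w(i):\alpha_{\varphi_*,w}(y)\le1\}$. Put $\theta(x)=\inf\{\lambda>0:\alpha_{\varphi,w}(x/\lambda)<\infty\}$. For a Banach function (or sequence) lattice $X$, $X_a$ is the closed subspace of order-continuous elements: those $x\in X$ such that $\|x_n\|\downarrow0$ whenever $0\le x_n\le|x|$ and $x_n\downarrow0$ a.e. In these spaces $(\Lambda_{\varphi,w})_a=\{f:\rho_{\varphi,w}(\lambda f)<\infty\ \text{for all}\ \lambda>0\}$ and $(\lambda_{\varphi,w})_a=\{x:\alpha_{\varphi,w}(\eta x)<\infty\ \text{for all}\ \eta>0\}$. A singular functional on $X$ is a bounded linear functional $S\in X^*$ with $S(x)=0$ for all $x\in X_a$. *)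

(* Defs.v *)
From HB Require Import structures.
From mathcomp Require Import all_boot all_order all_algebra.
From mathcomp Require Import all_classical all_reals all_analysis.

Set Implicit Arguments.
Unset Strict Implicit.
Unset Printing Implicit Defensive.
Import Order.TTheory GRing.Theory Num.Theory.
Import numFieldNormedType.Exports.

Local Open Scope classical_set_scope.
Local Open Scope ring_scope.
Local Open Scope ereal_scope.

Definition orlicz_function {R : realType} (phi : R -> R) : Prop :=
  [/\ convex_function (`[0%R, +oo[%classic : set R) phi,
      phi 0%R = 0%R &
      forall t : R, (0 < t)%R -> (0 < phi t)%R].

(* It can take the value +oo (e.g. phi u = u and v > 1). *)
Definition complementary {R : realType} (phi : R -> R) (v : R) : \bar R :=
  ereal_sup [set (u * v - phi u)%:E | u in `[0%R, +oo[%classic].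

(* Decreasing rearrangements take values in [0, +oo]. Orlicz functions and
   their complementary functions tend to +oo at +oo, hence the value there;
   -oo is never reached. *)
Definition ext_oo {R : realType} (Phi : R -> \bar R) (x : \bar R) : \bar R :=
  if x is r%:E then Phi r else +oo.

(* Elements of the spaces below are functions T -> R regarded up to equality
   mu-a.e. on D. A modular is a family rho indexed by the function Phi
   (phi or its complementary function) that is composed with the
   rearrangement. *)
Section modular_spaces.
Context {R : realType} {T : Type}.
Implicit Types (L X : set (T -> R)) (rho : (T -> R) -> \bar R).

Definition modular_space L rho : set (T -> R) :=
  [set f | L f /\
    exists2 l : R, (0 < l)%R & rho (fun t => l * f t)%R < +oo].

Definition luxemburg_norm rho (f : T -> R) : \bar R :=
  ereal_inf [set e%:E | e in
    [set e : R | (0 < e)%R /\ rho (fun t => f t / e)%R <= 1]].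

Definition orlicz_norm L (pairing : (T -> R) -> (T -> R) -> \bar R)
    (rho_star : (T -> R) -> \bar R) (f : T -> R) : \bar R :=
  ereal_sup [set pairing f g | g in [set g | L g /\ rho_star g <= 1]].

Definition theta rho (f : T -> R) : \bar R :=
  ereal_inf [set l%:E | l in
    [set l : R | (0 < l)%R /\ rho (fun t => f t / l)%R < +oo]].

Definition dual_norm X (N : (T -> R) -> \bar R) (S : (T -> R) -> R) : \bar R :=
  ereal_sup [set `|S f|%:E | f in X `&` [set f | N f <= 1]].

End modular_spaces.

Section lattices.
Context {R : realType} {d : measure_display} {T : measurableType d}.
Variables (mu : {measure set T -> \bar R}) (D : set T).
Variables (X : set (T -> R)) (N : (T -> R) -> \bar R).

Definition order_continuous : set (T -> R) := [set f | X f /\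
  forall u : nat -> T -> R,
    (forall n, X (u n)) ->
    (forall n, {ae mu, forall t, D t -> (0 <= u n t <= `|f t|)%R}) ->
    (forall n, {ae mu, forall t, D t -> (u n.+1 t <= u n t)%R}) ->
    {ae mu, forall t, D t -> (fun n => u n t) @ \oo --> (0 : R)%R} ->
    nonincreasing_seq (fun n => N (u n)) /\
    (fun n => N (u n)) @ \oo --> (0 : \bar R)].

(* S is only constrained on X; its values elsewhere are irrelevant. *)
Definition bounded_linear_functional (S : (T -> R) -> R) : Prop :=
  [/\ forall f g, X f -> X g ->
        {ae mu, forall t, D t -> f t = g t} -> S f = S g,
      forall (a : R) f g, X f -> X g ->
        S (fun t => a * f t + g t)%R = (a * S f + S g)%R &
      exists C : R, forall f, X f -> `|S f|%:E <= C%:E * N f].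

Definition singular_functional (S : (T -> R) -> R) : Prop :=
  bounded_linear_functional S /\ forall f, order_continuous f -> S f = 0%R.

End lattices.

Definition sup_or0 {R : realType} (A : set (\bar R)) : \bar R :=
  if A == set0 then 0 else ereal_sup A.

Section function_case.
Context {R : realType}.

(* R with the sigma-algebra of Lebesgue measurable sets, the domain of
   completed_lebesgue_measure. *)
Definition lebesgueType :=
  caratheodory_type (R := R) ((@wlength R idfun)^*)%mu.

Notation m := (@completed_lebesgue_measure R).

Variable gamma : \bar R.

Definition I_ : set R := [set t | (0 <= t)%R /\ t%:E < gamma].

(* Monotonicity is required off 0 only, so that weights unbounded near 0
   such as 1 / sqrt t are included; the value at 0 is immaterial. *)
Definition function_weight (w : R -> R) : Prop :=
  [/\ forall t, I_ t -> (0 < w t)%R,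
      forall s t, (0 < s)%R -> (s <= t)%R -> I_ t -> (w t <= w s)%R,
      forall t, I_ t ->
        \int[lebesgue_measure]_(s in `[0%R, t]) (w s)%:E < +oo &
      gamma = +oo ->
        \int[lebesgue_measure]_(s in `[0%R, +oo[) (w s)%:E = +oo].

Definition L0 : set (lebesgueType -> R) :=
  [set f | measurable_fun (I_ : set lebesgueType) f].

Definition distr_fun (f : lebesgueType -> R) (l : R) : \bar R :=
  m [set t : lebesgueType | I_ t /\ (l < `|f t|)%R].

Definition rearr_fun (f : lebesgueType -> R) (t : R) : \bar R :=
  ereal_inf [set l%:E | l in
    [set l : R | (0 < l)%R /\ distr_fun f l <= t%:E]].

(* The integrands below are products of monotone functions, hence Borel, so
   the Borel restriction lebesgue_measure of m suffices. *)
Definition rho_fun (w : R -> R) (Phi : R -> \bar R)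
    (f : lebesgueType -> R) : \bar R :=
  \int[lebesgue_measure]_(t in I_) (ext_oo Phi (rearr_fun f t) * (w t)%:E).

Definition pairing_fun (w : R -> R) (f g : lebesgueType -> R) : \bar R :=
  \int[lebesgue_measure]_(t in I_)
    (rearr_fun f t * rearr_fun g t * (w t)%:E).

Variables (phi w : R -> R).

Definition rho : (lebesgueType -> R) -> \bar R := rho_fun w (EFin \o phi).

Definition Lambda : set (lebesgueType -> R) := modular_space L0 rho.

Definition Lambda_lux : (lebesgueType -> R) -> \bar R := luxemburg_norm rho.

Definition Lambda_orl : (lebesgueType -> R) -> \bar R :=
  orlicz_norm L0 (pairing_fun w) (rho_fun w (complementary phi)).

Definition Lambda_a : set (lebesgueType -> R) :=
  order_continuous m I_ Lambda Lambda_lux.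

Definition singular_Lambda (N : (lebesgueType -> R) -> \bar R) :
    ((lebesgueType -> R) -> R) -> Prop :=
  singular_functional m I_ Lambda N.

End function_case.
Arguments lebesgueType : clear implicits.

(* The term of index i >= 1 of a sequence x is x i.-1. *)
Section sequence_case.
Context {R : realType}.

Definition sequence_weight (w : nat -> R) : Prop :=
  [/\ forall i, (0 < w i)%R,
      nonincreasing_seq w &
      \sum_(0 <= i <oo) (w i)%:E = +oo].

Definition distr_seq (x : nat -> R) (l : R) : \bar R :=
  counting [set k | (l < `|x k|)%R].

Definition rearr_seq (x : nat -> R) (i : nat) : \bar R :=
  ereal_inf [set l%:E | l in
    [set l : R | (0 < l)%R /\ distr_seq x l < i.+1%:R%:E]].

Definition alpha_seq (w : nat -> R) (Phi : R -> \bar R)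
    (x : nat -> R) : \bar R :=
  \sum_(0 <= i <oo) (ext_oo Phi (rearr_seq x i) * (w i)%:E).

Definition pairing_seq (w : nat -> R) (x y : nat -> R) : \bar R :=
  \sum_(0 <= i <oo) (rearr_seq x i * rearr_seq y i * (w i)%:E).

Variables (phi : R -> R) (w : nat -> R).

Definition alpha : (nat -> R) -> \bar R := alpha_seq w (EFin \o phi).

Definition lambda : set (nat -> R) := modular_space setT alpha.

Definition lambda_lux : (nat -> R) -> \bar R := luxemburg_norm alpha.

Definition lambda_orl : (nat -> R) -> \bar R :=
  orlicz_norm setT (pairing_seq w) (alpha_seq w (complementary phi)).

Definition lambda_a : set (nat -> R) :=
  order_continuous (@counting nat R) setT lambda lambda_lux.

Definition singular_lambda (N : (nat -> R) -> \bar R) :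
    ((nat -> R) -> R) -> Prop :=
  singular_functional (@counting nat R) setT lambda N.

End sequence_case.

(* Main.v *)
(* Idea. A function of finite modular is the sum of its truncation (bounded,
   with support of finite weight), which is order continuous and hence killed by
   a singular functional S, and of a remainder whose modular tends to 0 by
   dominated convergence. By Young's inequality the Orlicz norm is at most 1
   plus the modular, so S only sees functions of Orlicz norm close to 1: S is
   bounded by its Orlicz dual norm on functions of finite modular. Conversely
   the Orlicz unit ball lies in the Luxemburg unit ball (test against
   g = p(|f|), p a subgradient of phi), which up to a factor 1 + e consists of
   functions of finite modular. The last supremum is the homogeneous form of the
   third one, as f / l has finite modular for all l > theta(f). *)
Require Import Defs.
From mathcomp Require Import all_boot all_order all_algebra.
From mathcomp Require Import all_classical all_reals all_analysis.
From mathcomp Require Import measurable_realfun ring lra.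

Set Implicit Arguments.
Unset Strict Implicit.
Unset Printing Implicit Defensive.
Import Order.TTheory GRing.Theory Num.Theory.
Import numFieldNormedType.Exports.

Local Open Scope classical_set_scope.
Local Open Scope ring_scope.

(** The delicate point is the inclusion of the Orlicz unit ball in the Luxemburg one. The pairing
    involves rearrangements only, so equality in Young's inequality is needed between the
    rearrangements of [f] and of [g = p(|f|)], and the two need not be related by [p] pointwise.
    Moreover [g] is admissible as a test function only if its complementary modular is at most 1;
    otherwise [g] is divided by that modular, which must therefore be finite. Finiteness is
    available for bounded functions supported in a set of finite weight, so the estimate is made for
    truncations and passed to [f] by monotone convergence. The limit only controls values strictly
    below the rearrangement of [f]; this is the reason for dividing [f] by [1 + e], which is
    harmless for an infimum. Order continuity refers to a norm, so the two readings of singular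
    could differ. The bound of the Orlicz norm by twice the Luxemburg norm shows that either reading
    makes [S] vanish on the elements that are order continuous for the Luxemburg norm, in particular
    on truncations. *)

(** * Convexity: subgradients, the complementary function and Young's inequality *)

Section orlicz_function_theory.
Context {R : realType} (phi : R -> R).
Hypothesis hphi : orlicz_function phi.

Lemma orlicz0 : phi 0 = 0. Proof. by case: hphi. Qed.

Lemma orlicz_gt0 t : 0 < t -> 0 < phi t. Proof. by case: hphi => _ _; apply. Qed.

Lemma orlicz_ge0 t : 0 <= t -> 0 <= phi t.
Proof.
by rewrite le_eqVlt => /predU1P[<-|/orlicz_gt0/ltW//]; rewrite orlicz0.
Qed.

Lemma orlicz_conv t x y : 0 <= x -> 0 <= y -> 0 <= t -> t <= 1 ->
  phi (t * x + (1 - t) * y) <= t * phi x + (1 - t) * phi y.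
Proof.
move=> x0 y0 t0 t1; have [cphi _ _] := hphi.
have := cphi (Itv01 t0 t1) x y; rewrite !inE/= !in_itv/= !andbT.
by move=> /(_ x0 y0); rewrite !convRE.
Qed.

Lemma orlicz_scale t x : 0 <= x -> 0 <= t -> t <= 1 -> phi (t * x) <= t * phi x.
Proof.
move=> x0 t0 t1; have := orlicz_conv x0 (lexx 0) t0 t1.
by rewrite orlicz0 !mulr0 !addr0.
Qed.

Lemma orlicz_le x y : 0 <= x -> x <= y -> phi x <= phi y.
Proof.
move=> x0 xy; have y0 := le_trans x0 xy.
move: x0; rewrite le_eqVlt => /predU1P[<-|x0]; first by rewrite orlicz0 orlicz_ge0.
have y1 : 0 < y by exact: lt_le_trans xy.
have := @orlicz_scale (x / y) y y0.
rewrite divfK ?gt_eqF// => h; apply: (le_trans (h _ _)).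
- by rewrite divr_ge0// ltW.
- by rewrite ler_pdivrMr// mul1r.
- by rewrite ler_piMl ?orlicz_ge0// ler_pdivrMr// mul1r.
Qed.

(** This is convexity with [u] written as the combination of [x] and [y] of weight
    [(y - u) / (y - x)]. It bounds the right slopes at [u] from below by any left slope, so that
    their infimum exists. *)
Lemma orlicz_slope x u y : 0 <= x -> x < u -> u < y ->
  (phi u - phi x) / (u - x) <= (phi y - phi u) / (y - u).
Proof.
move=> x0 xu uy; have yx : 0 < y - x by lra.
have ux : 0 < u - x by lra. have yu : 0 < y - u by lra.
have t0 : 0 <= (y - u) / (y - x) by rewrite divr_ge0// ltW.
have t1 : (y - u) / (y - x) <= 1 by rewrite ler_pdivrMr// mul1r; lra.
have y0 : 0 <= y by lra.
have := orlicz_conv x0 y0 t0 t1.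
have -> : (y - u) / (y - x) * x + (1 - (y - u) / (y - x)) * y = u.
  by field; rewrite gt_eqF.
have -> : (y - u) / (y - x) * phi x + (1 - (y - u) / (y - x)) * phi y =
   ((y - u) * phi x + (u - x) * phi y) / (y - x).
  by field; rewrite gt_eqF.
rewrite ler_pdivlMr// => h; rewrite ler_pdivrMr// mulrAC ler_pdivlMr//.
nra.
Qed.

(** For [u > 0] this is the right derivative of [phi]. The right derivative at 0 may be positive (as
    for [phi u = u]); the value 0 is chosen there, also a subgradient, so that [p(|f|)] vanishes
    wherever [f] does. *)
Definition subgradient (u : R) : R :=
  if u <= 0 then 0 else inf [set (phi y - phi u) / (y - u) | y in [set y | u < y]].

Lemma subgradientP u x : 0 <= u -> 0 <= x ->
  subgradient u * (x - u) <= phi x - phi u.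
Proof.
move=> u0 x0; rewrite /subgradient; case: ifPn => [ule|].
  have -> : u = 0 by lra.
  by rewrite mul0r orlicz0 subr0 orlicz_ge0.
rewrite -ltNge => ugt0.
set A := (X in inf X).
have A0 : A !=set0 by exists ((phi (u + 1) - phi u) / (u + 1 - u)), (u + 1) => //=; lra.
have lbA z : 0 <= z -> z < u -> lbound A ((phi u - phi z) / (u - z)).
  by move=> z0 zu _ [y /= uy <-]; exact: orlicz_slope.
have [xu|ux|->] := ltgtP x u; last by rewrite !subrr mulr0.
- have := lb_le_inf A0 (lbA _ x0 xu).
  rewrite ler_pdivrMr ?subr_gt0// => h; nra.
- have : inf A <= (phi x - phi u) / (x - u).
    apply: ge_inf; last by exists x.
    by exists ((phi u - phi 0) / (u - 0)); apply: lbA.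
  by rewrite ler_pdivlMr ?subr_gt0.
Qed.

Lemma subgradient_npos u : u <= 0 -> subgradient u = 0.
Proof. by rewrite /subgradient => ->. Qed.

Lemma subgradient_ge0 u : 0 <= subgradient u.
Proof.
have [u0|u0] := leP u 0; first by rewrite subgradient_npos.
have := subgradientP (ltW u0) (lexx 0); have := orlicz_gt0 u0.
rewrite orlicz0 => h1 h2; rewrite -(pmulr_lge0 _ u0); lra.
Qed.

Lemma subgradient_le : {homo subgradient : u v / u <= v}.
Proof.
move=> u v uv; have [u0|u0] := leP u 0.
  by rewrite (subgradient_npos u0) subgradient_ge0.
move: uv; rewrite le_eqVlt => /predU1P[->//|uv]; have v0 := lt_trans u0 uv.
have h1 := subgradientP (ltW u0) (ltW v0).
have h2 := subgradientP (ltW v0) (ltW u0).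
have vu : 0 < v - u by lra.
rewrite -(ler_pM2r vu); lra.
Qed.

Local Open Scope ereal_scope.

Lemma complementary_ge0 (v : R) : 0 <= complementary phi v.
Proof.
apply: ereal_sup_ubound; exists 0%R; first by rewrite /= in_itv/= lexx.
by rewrite mul0r orlicz0 subrr.
Qed.

Lemma complementary_le (u v : R) : (0 <= u)%R -> (u <= v)%R ->
  complementary phi u <= complementary phi v.
Proof.
move=> u0 uv; apply: ge_ereal_sup => y [x /=]; rewrite in_itv/= andbT => x0 <-.
apply: le_ereal_sup_tmp; exists (x * v - phi x)%:E.
  by exists x => //=; rewrite in_itv/= x0.
by rewrite lee_fin lerD2r ler_wpM2l.
Qed.

Lemma complementary0 : complementary phi 0 = 0.
Proof.
apply/eqP; rewrite eq_le complementary_ge0 andbT.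
apply: ge_ereal_sup => y [x /=]; rewrite in_itv/= andbT => x0 <-.
by rewrite mulr0 sub0r lee_fin oppr_le0 orlicz_ge0.
Qed.

(** Since [phi >= 0], each [x * v / k - phi x] is at most [(x * v - phi x) / k]. This brings a test
    function of too large complementary modular back to modular at most 1. *)
Lemma complementary_div (v k : R) : (1 <= k)%R ->
  complementary phi (v / k) <= k^-1%:E * complementary phi v.
Proof.
move=> k1; have k0 : (0 < k)%R by lra.
apply: ge_ereal_sup => y [x /=]; rewrite in_itv/= andbT => x0 <-.
apply: (@le_trans _ _ (k^-1%:E * (x * v - phi x)%:E)).
  have : (k^-1 * phi x <= phi x)%R by rewrite ler_piMl ?orlicz_ge0// invf_le1.
  by rewrite -EFinM lee_fin; nra.
rewrite lee_pmul2l// ?lte_fin ?invr_gt0//; apply: ereal_sup_ubound.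
by exists x => //=; rewrite in_itv/= x0.
Qed.

Lemma young (u v : R) : (0 <= u)%R ->
  (u * v)%:E <= (phi u)%:E + complementary phi v.
Proof.
move=> u0; rewrite -leeBlDl// -EFinB; apply: ereal_sup_ubound.
by exists u => //=; rewrite in_itv/= u0.
Qed.

(** If [v] is a subgradient at [u], the supremum defining the complementary function is attained at
    [u]. *)
Lemma young_eq (u v : R) : (0 <= u)%R ->
  (forall x, 0 <= x -> v * (x - u) <= phi x - phi u)%R ->
  complementary phi v = (u * v - phi u)%:E.
Proof.
move=> u0 h; apply/eqP; rewrite eq_le; apply/andP; split; last first.
  by apply: ereal_sup_ubound; exists u => //=; rewrite in_itv/= u0.
apply: ge_ereal_sup => y [x /=]; rewrite in_itv/= andbT => x0 <-.
by rewrite lee_fin; have := h _ x0; lra.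
Qed.

End orlicz_function_theory.

Local Open Scope ereal_scope.

(** * Limits and slack arguments in the extended reals *)

Section ereal_facts.
Context {R : realType}.

Lemma cvge0_le (x : nat -> \bar R) : (forall n, 0 <= x n) ->
  (forall e : R, (0 < e)%R -> \forall n \near \oo, x n <= e%:E) ->
  x n @[n --> \oo] --> 0.
Proof.
move=> x0 h; apply/fine_cvgP; split.
  apply: filterS (h _ ltr01) => n xn.
  by rewrite ge0_fin_numE// (le_lt_trans xn)// ltry.
apply/cvgrPdist_le => e e0; apply: filterS (h _ e0) => n xn /=.
rewrite sub0r normrN ger0_norm ?fine_ge0//.
by move: (x0 n) xn; case: (x n).
Qed.

Lemma lee_scale_gt1 (x : R) (s : \bar R) : 0 <= s ->
  (forall e : R, (0 < e)%R -> x%:E <= (1 + e)%:E * s) -> x%:E <= s.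
Proof.
case: s => [r| |]//; last by move=> *; rewrite leey.
rewrite !lee_fin => r0 h; apply/ler_addgt0Pr => e e0.
have r1 : (0 < r + 1)%R by lra.
(* The denominator is [r + 1] because [r] may be 0. *)
have := h (e / (r + 1))%R (divr_gt0 e0 r1); rewrite -EFinM lee_fin.
move=> /le_trans; apply; rewrite mulrDl mul1r lerD2l mulrAC.
by rewrite ler_pdivrMr// ler_pM2l//; lra.
Qed.

Lemma slack_le (a b c : R) :
  (forall e, (0 < e)%R -> (e < 1)%R -> (a <= b + e * c)%R) -> (a <= b)%R.
Proof.
move=> h; rewrite leNgt; apply/negP => ba.
(* [k] exceeds both [a - b] and [c], so the slack [(a - b) / k] is below 1 and its product with [c]
   stays below [a - b]. *)
pose k := (`|c| + (a - b) + 1)%R.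
have c0 : (0 <= `|c|)%R by [].
have cc : (c <= `|c|)%R by rewrite ler_norm.
have k0 : (0 < k)%R by rewrite /k; lra.
have e0 : (0 < (a - b) / k)%R by rewrite divr_gt0 ?subr_gt0.
have e1 : ((a - b) / k < 1)%R by rewrite ltr_pdivrMr// /k; lra.
have := h _ e0 e1; rewrite leNgt => /negP; apply.
rewrite -ltrBrDl mulrAC ltr_pdivrMr// /k; nra.
Qed.

Lemma ext_oo_le (Phi : R -> \bar R) (x y : \bar R) :
  (forall u v : R, (0 <= u)%R -> (u <= v)%R -> Phi u <= Phi v) ->
  0 <= x -> x <= y -> ext_oo Phi x <= ext_oo Phi y.
Proof.
move=> Phi_le; case: x y => [x| |] [y| |]//=; rewrite ?lee_fin ?leey//.
exact: Phi_le.
Qed.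

Lemma ext_oo_ge0 (Phi : R -> \bar R) (x : \bar R) :
  (forall u, (0 <= u)%R -> 0 <= Phi u) -> 0 <= x -> 0 <= ext_oo Phi x.
Proof. by move=> Phi_ge0; case: x => [x| |]//=; exact: Phi_ge0. Qed.

End ereal_facts.

(** * Decreasing rearrangements *)

(* Function and sequence spaces are treated at once: [f] lives on [(D, mu)] and
   its rearrangement on an index set [J] where [j] stands for the real
   number [kappa j]: [kappa] is the identity for functions, and the inclusion
   of nat for sequences. *)
Section rearrangement.
Context {R : realType} {d : measure_display} {T : measurableType d}.
Variables (mu : {measure set T -> \bar R}) (D : set T).
Hypothesis mD : measurable D.
Context {J : Type}.
Variable (kappa : J -> R).

Implicit Types (f g : T -> R) (l c : R) (j : J).

Definition level_mass f l : \bar R := mu [set t | D t /\ (l < `|f t|)%R].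

Definition rearr f j : \bar R := ereal_inf [set l%:E | l in
  [set l : R | (0 < l)%R /\ level_mass f l <= (kappa j)%:E]].

Lemma measurable_level f l : measurable_fun D f ->
  measurable [set t | D t /\ (l < `|f t|)%R].
Proof.
move=> mf; have mn : measurable_fun D (fun t => `|f t|%R).
  exact: measurableT_comp.
have := mn mD `]l, +oo[%classic (measurable_itv _).
by congr measurable; apply/seteqP; split=> t /=; rewrite in_itv/= andbT.
Qed.

Lemma level_mass_le f g l : measurable_fun D f -> measurable_fun D g ->
  {ae mu, forall t, D t -> (`|f t| <= `|g t|)%R} -> level_mass f l <= level_mass g l.
Proof.
move=> mf mg [N [mN N0 fgN]].
apply: (@le_trans _ _ (mu ([set t | D t /\ (l < `|g t|)%R] `|` N))).
  apply: le_measure; rewrite ?inE//; first exact: measurable_level.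
    by apply: measurableU => //; exact: measurable_level.
  move=> t [Dt lf]; have [fg|fg] := leP (`|f t|)%R (`|g t|)%R.
    by left; split=> //; exact: lt_le_trans fg.
  by right; apply: fgN => /= /(_ Dt); rewrite leNgt fg.
by rewrite (le_trans (measureU2 _ _ _))//= ?N0 ?adde0//; exact: measurable_level.
Qed.

Lemma level_mass_anti f l c : measurable_fun D f -> (l <= c)%R ->
  level_mass f c <= level_mass f l.
Proof.
move=> mf lc; apply: le_measure; rewrite ?inE; [exact: measurable_level..|].
by move=> t [Dt cf]; split => //; exact: le_lt_trans cf.
Qed.

Lemma level_massZ f l c : (0 < c)%R ->
  level_mass (fun t => c * f t)%R l = level_mass f (l / c)%R.
Proof.
move=> c0; rewrite /level_mass; congr (mu _); apply/seteqP.
by split=> t /= []; rewrite normrM (gtr0_norm c0) ltr_pdivrMr// mulrC.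
Qed.

Lemma rearr_ge0 f j : 0 <= rearr f j.
Proof.
by apply: le_ereal_inf_tmp => _ [l [/ltW l0 _] <-]; rewrite lee_fin.
Qed.

Lemma rearr_le_fin f j l : (0 < l)%R -> level_mass f l <= (kappa j)%:E ->
  rearr f j <= l%:E.
Proof. by move=> l0 fl; apply: ereal_inf_lbound; exists l. Qed.

Lemma rearr_ge_fin f j l : measurable_fun D f ->
  (kappa j)%:E < level_mass f l -> l%:E <= rearr f j.
Proof.
move=> mf fl; apply: le_ereal_inf_tmp => _ [c [_ fc] <-].
rewrite lee_fin leNgt; apply/negP => /ltW cl.
by have := lt_le_trans fl (le_trans (level_mass_anti mf cl) fc); rewrite ltxx.
Qed.

Lemma rearr_lt f j l : measurable_fun D f -> (0 < l)%R -> rearr f j < l%:E ->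
  level_mass f l <= (kappa j)%:E.
Proof.
move=> mf l0 /ereal_inf_lt[_ [c [_ fc] <-]]; rewrite lte_fin => /ltW cl.
exact: le_trans (level_mass_anti mf cl) fc.
Qed.

Lemma rearr_gt f j l : (0 < l)%R -> l%:E < rearr f j ->
  (kappa j)%:E < level_mass f l.
Proof.
move=> l0 lf; rewrite ltNge; apply/negP => /(rearr_le_fin l0).
by rewrite leNgt lf.
Qed.

Lemma rearr_le f g j : measurable_fun D f -> measurable_fun D g ->
  {ae mu, forall t, D t -> (`|f t| <= `|g t|)%R} -> rearr f j <= rearr g j.
Proof.
move=> mf mg fg; apply: ereal_inf_le_tmp => _ [l [l0 gl] <-]; exists l => //.
by split => //; exact: le_trans (level_mass_le l mf mg fg) gl.
Qed.

(** One inequality for every positive factor suffices: the reverse one is the same inequality for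
    [c^-1], applied to the scaled function. *)
Lemma rearrZ f j c : (0 < c)%R ->
  rearr (fun t => c * f t)%R j = c%:E * rearr f j.
Proof.
have le_rearrZ h b : (0 < b)%R ->
    rearr (fun t => b * h t)%R j <= b%:E * rearr h j.
  move=> b0; rewrite -lee_pdivrMl//; apply: le_ereal_inf_tmp => _ [l [l0 hl] <-].
  rewrite lee_pdivrMl// -EFinM; apply: rearr_le_fin; first exact: mulr_gt0.
  by rewrite level_massZ// mulrAC divff ?mul1r// gt_eqF.
move=> c0; apply/eqP; rewrite eq_le le_rearrZ//= -lee_pdivlMl//.
have := @le_rearrZ (fun t => c * f t)%R (c^-1)%R; rewrite invr_gt0 => /(_ c0).
by under eq_fun do rewrite mulrA mulVf ?gt_eqF// mul1r.
Qed.

Lemma rearr_anti f i j : (kappa i <= kappa j)%R -> rearr f j <= rearr f i.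
Proof.
move=> ij; apply: ereal_inf_le_tmp => _ [l [l0 fl] <-]; exists l => //.
by split=> //; apply: le_trans fl _; rewrite lee_fin.
Qed.

Lemma eq_rearr f g j : (forall t, D t -> `|f t| = `|g t|)%R ->
  rearr f j = rearr g j.
Proof.
move=> fg; rewrite /rearr /level_mass; congr ereal_inf.
have fgl l : [set t | D t /\ (l < `|f t|)%R] = [set t | D t /\ (l < `|g t|)%R].
  by apply/seteqP; split=> t /= [Dt]; rewrite fg.
by apply/seteqP; split=> _ [l [l0 fl] <-]; exists l => //; split=> //; rewrite ?fgl// -fgl.
Qed.

(** Dominated convergence for indicators of level sets: at almost every point [u n] is eventually
    below [l], and the level set of [f], of finite mass, dominates. *)
Lemma cvg_level_mass (u : nat -> T -> R) f l : (0 < l)%R ->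
  (forall n, measurable_fun D (u n)) -> measurable_fun D f ->
  (forall n, {ae mu, forall t, D t -> (`|u n t| <= `|f t|)%R}) ->
  {ae mu, forall t, D t -> u n t @[n --> \oo] --> (0 : R)%R} ->
  level_mass f l < +oo -> level_mass (u n) l @[n --> \oo] --> 0.
Proof.
move=> l0 mu_ mf uf u0 fl.
pose A n := [set t | D t /\ (l < `|u n t|)%R].
have mA n : measurable (A n) by exact: measurable_level.
pose B := [set t | D t /\ (l < `|f t|)%R].
have mB : measurable B by exact: measurable_level.
have AE n : level_mass (u n) l = \int[mu]_(t in D) (\1_(A n) t)%:E.
  by rewrite integral_indic//; congr (mu _); apply/seteqP; split=> t; [move=> [? ?]; split|case].
have := @dominated_convergence _ _ _ mu D mD
  (fun n t => (\1_(A n) t)%:E) (cst 0) (fun t => (\1_B t)%:E).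
case.
- by move=> n; apply/measurable_EFinP; exact: measurable_indic.
- exact: measurable_cst.
- apply: filterS u0 => t /[apply] ut.
  apply: cvg_near_cst; move/cvgr0Pnorm_lt : ut => /(_ _ l0).
  apply: filterS => n /ltW ul; rewrite indicE memNset//.
  by move=> [_]; rewrite ltNge ul.
- apply/integrableP; split.
    by apply/measurable_EFinP; exact: measurable_indic.
  under eq_integral do rewrite gee0_abs ?lee_fin//.
  by rewrite integral_indic// setIidl// => t [].
- have := @ae_foralln _ _ _ mu (fun n t => D t -> (`|u n t| <= `|f t|)%R) uf.
  apply: filterS => t uft n Dt.
  rewrite gee0_abs ?lee_fin// !indicE ler_nat.
  case: (boolP (t \in A n)) => [/set_mem[_ ul]|_]; last by case: (_ \in _).
  by rewrite mem_set//; split => //; exact: lt_le_trans ul (uft _ Dt).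
- by move=> _ _; rewrite integral_cst// mul0e -(funext AE).
Qed.

End rearrangement.

(** * Orlicz-Lorentz spaces over a general index set *)

Section orlicz_lorentz.
Context {R : realType} {d : measure_display} {T : measurableType d}.
Variables (mu : {measure set T -> \bar R}) (D : set T).
Hypothesis mD : measurable D.
Context {d' : measure_display} {J : measurableType d'}.
Variables (nu : {measure set J -> \bar R}) (E : set J) (kappa w : J -> R).
Hypothesis mE : measurable E.
Hypothesis mkappa : measurable_fun E kappa.
Hypothesis mw : measurable_fun E w.
Hypothesis w_gt0 : forall j, E j -> (0 < w j)%R.

Implicit Types (f g : T -> R) (l c : R) (j : J) (Phi : R -> \bar R).

Local Notation distr := (level_mass mu D).
Local Notation rearr := (rearr mu D kappa).
Local Notation mfun := (measurable_fun D).

Definition modular Phi f : \bar R :=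
  \int[nu]_(j in E) (ext_oo Phi (rearr f j) * (w j)%:E).

Definition pairing f g : \bar R :=
  \int[nu]_(j in E) (rearr f j * rearr g j * (w j)%:E).

(** [J] carries no order. Antitonicity along [kappa] makes each set where [h > r] the trace on [E]
    of the preimage of a down-closed set of reals, which is an interval. *)
Lemma measurable_anti (h : J -> \bar R) :
  (forall i j, E i -> E j -> (kappa i <= kappa j)%R -> h j <= h i) ->
  measurable_fun E h.
Proof.
move=> h_anti; apply: (measurability _ (ErealGenOInfty.measurableE R)).
move=> _ [_ [r ->]] <-.
pose B := [set x : R | exists2 j, (x <= kappa j)%R & E j /\ r%:E < h j].
have mB : measurable B.
  apply: is_interval_measurable => x y _ [j yj hj] z /andP[xz zy].
  by exists j => //; exact: le_trans yj.
have := mkappa mE mB; congr measurable; apply/seteqP; split=> j /= [Ej].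
  move=> [i ji [Ei hi]]; split => //; rewrite in_itv/= andbT.
  exact: lt_le_trans (h_anti _ _ Ej Ei ji).
by rewrite in_itv/= andbT => hj; split => //; exists j.
Qed.

Let mwE : measurable_fun E (EFin \o w).
Proof. exact/measurable_EFinP. Qed.

Lemma measurable_rearr f : measurable_fun E (rearr f).
Proof. by apply: measurable_anti => i j _ _; exact: rearr_anti. Qed.

Section modular_theory.
Variable Phi : R -> \bar R.
Hypothesis Phi_ge0 : forall u, (0 <= u)%R -> 0 <= Phi u.
Hypothesis Phi_le : forall u v, (0 <= u)%R -> (u <= v)%R -> Phi u <= Phi v.

Lemma modular_integrand_ge0 f j : E j ->
  0 <= ext_oo Phi (rearr f j) * (w j)%:E.
Proof.
move=> Ej; rewrite mule_ge0//; first by apply: ext_oo_ge0 => //; exact: rearr_ge0.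
by rewrite lee_fin ltW// w_gt0.
Qed.

Lemma measurable_ext_rearr f : measurable_fun E (fun j => ext_oo Phi (rearr f j)).
Proof.
apply: measurable_anti => i j _ _ ij; apply: ext_oo_le => //.
  exact: rearr_ge0.
exact: rearr_anti.
Qed.

Lemma measurable_modular_integrand f :
  measurable_fun E (fun j => ext_oo Phi (rearr f j) * (w j)%:E).
Proof. by apply: emeasurable_funM => //; exact: measurable_ext_rearr. Qed.

Lemma modular_ge0 f : 0 <= modular Phi f.
Proof. by apply: integral_ge0 => j; exact: modular_integrand_ge0. Qed.

Lemma modular_le f g : mfun f -> mfun g ->
  {ae mu, forall t, D t -> (`|f t| <= `|g t|)%R} ->
  modular Phi f <= modular Phi g.
Proof.
move=> mf mg fg; apply: ge0_le_integral => //.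
- by move=> j; exact: modular_integrand_ge0.
- exact: measurable_modular_integrand.
- exact: measurable_modular_integrand.
- move=> j Ej; rewrite lee_pmul2r ?lte_fin ?w_gt0//.
  by apply: ext_oo_le => //; [exact: rearr_ge0|exact: rearr_le].
Qed.

End modular_theory.

Lemma eq_modular Phi f g : (forall t, D t -> `|f t| = `|g t|)%R ->
  modular Phi f = modular Phi g.
Proof.
by move=> fg; apply: eq_integral => j _; rewrite (eq_rearr _ _ _ fg).
Qed.

Lemma pairing_integrand_ge0 f g j : E j ->
  0 <= rearr f j * rearr g j * (w j)%:E.
Proof.
move=> Ej; rewrite mule_ge0 ?lee_fin ?(ltW (w_gt0 _))//.
by rewrite mule_ge0// rearr_ge0.
Qed.

Lemma measurable_pairing_integrand f g :
  measurable_fun E (fun j => rearr f j * rearr g j * (w j)%:E).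
Proof.
by apply: emeasurable_funM => //; apply: emeasurable_funM; exact: measurable_rearr.
Qed.

Lemma pairing_ge0 f g : 0 <= pairing f g.
Proof. by apply: integral_ge0 => j; exact: pairing_integrand_ge0. Qed.

Lemma pairing_le f1 f2 g : mfun f1 -> mfun f2 ->
  {ae mu, forall t, D t -> (`|f1 t| <= `|f2 t|)%R} ->
  pairing f1 g <= pairing f2 g.
Proof.
move=> m1 m2 f12; apply: ge0_le_integral => //.
- by move=> j; exact: pairing_integrand_ge0.
- exact: measurable_pairing_integrand.
- exact: measurable_pairing_integrand.
- move=> j Ej; rewrite lee_pmul2r ?lte_fin ?w_gt0//.
  by rewrite lee_wpmul2r ?rearr_ge0//; exact: rearr_le.
Qed.

Lemma pairingZl f g c : (0 < c)%R ->
  pairing (fun t => c * f t)%R g = c%:E * pairing f g.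
Proof.
move=> c0; rewrite /pairing -ge0_integralZl//.
- by apply: eq_integral => j _; rewrite rearrZ// !muleA.
- exact: measurable_pairing_integrand.
- by move=> j; exact: pairing_integrand_ge0.
- by rewrite lee_fin ltW.
Qed.

Lemma pairingC f g : pairing f g = pairing g f.
Proof. by apply: eq_integral => j _; rewrite (muleC (rearr f j)). Qed.

(** * Standing assumptions on the Orlicz function, the weight and an exhaustion of [D] *)

Variable phi : R -> R.
Hypothesis hphi : orlicz_function phi.
Hypothesis w_infty : mu D = +oo -> \int[nu]_(j in E) (w j)%:E = +oo.
Hypothesis kappa_ge0 : forall j, E j -> (0 <= kappa j)%R.
(* Satisfied with [e = kappa j] (off [j = 0]) for Lebesgue measure, and with
   [e = 1] for counting measure. *)
Hypothesis kappa_small : {ae nu, forall j, E j -> exists2 e : R, (0 < e)%R &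
  forall A, measurable A -> A `<=` D -> mu A < e%:E -> mu A <= (kappa j)%:E}.
(** In the two applications these are intervals [[0, a n]] with [a n] in [I], and the first [n]
    indices. The integral in [D_w] is then the primitive [W] of the weight at [mu (D_ n)]: functions
    supported in [D_ n] have rearrangements living there. *)
Variable D_ : nat -> set T.
Hypothesis mD_ : forall n, measurable (D_ n).
Hypothesis D_D : forall n, D_ n `<=` D.
Hypothesis D_le : forall n m, (n <= m)%N -> D_ n `<=` D_ m.
Hypothesis D_cover : forall t, D t -> exists n, D_ n t.
Hypothesis D_w : forall n,
  \int[nu]_(j in E `&` [set j | (kappa j)%:E < mu (D_ n)]) (w j)%:E < +oo.

Local Notation rho := (modular (EFin \o phi)).
Local Notation rho_star := (modular (complementary phi)).
Local Notation L := [set f : T -> R | measurable_fun D f].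
Local Notation X := (modular_space L rho).
Local Notation lux := (luxemburg_norm rho).
Local Notation orl := (orlicz_norm L pairing rho_star).

Let phi_ge0 u : (0 <= u)%R -> 0 <= (EFin \o phi) u.
Proof. by move=> u0; rewrite lee_fin orlicz_ge0. Qed.

Let phi_le u v : (0 <= u)%R -> (u <= v)%R ->
  (EFin \o phi) u <= (EFin \o phi) v.
Proof. by move=> u0 uv; rewrite lee_fin orlicz_le. Qed.

Let phis_ge0 u : (0 <= u)%R -> 0 <= complementary phi u.
Proof. by move=> u0; exact: complementary_ge0. Qed.

Let phis_le u v : (0 <= u)%R -> (u <= v)%R ->
  complementary phi u <= complementary phi v.
Proof. exact: complementary_le. Qed.

(** * Dominated convergence for modulars *)

Lemma mfunZ f c : mfun f -> mfun (fun t => c * f t)%R.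
Proof. by move=> mf; apply: measurable_funM => //; exact: measurable_cst. Qed.

Lemma mfunV f c : mfun f -> mfun (fun t => f t / c)%R.
Proof. by move=> mf; apply: measurable_funM => //; exact: measurable_cst. Qed.

(** If a level set had infinite mass, the rearrangement would be at least [l] on all of [E], and the
    infinite total weight would make the modular infinite. *)
Lemma level_mass_lty f l : mfun f -> (0 < l)%R -> rho f < +oo ->
  distr f l < +oo.
Proof.
move=> mf l0; rewrite !ltey; apply: contra_neq => dl.
have muD : mu D = +oo.
  apply/eqP; rewrite -leye_eq -dl; apply: le_measure; rewrite ?inE//.
    exact: measurable_level.
  by move=> t [].
apply/eqP; rewrite -leye_eq.
have -> : +oo = (phi l)%:E * \int[nu]_(j in E) (w j)%:E.
  by rewrite w_infty// gt0_muley// lte_fin; exact: orlicz_gt0.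
rewrite -ge0_integralZl//; last 2 first.
  by move=> j Ej; rewrite lee_fin ltW// w_gt0.
  by rewrite lee_fin orlicz_ge0// ltW.
apply: ge0_le_integral => //.
- by move=> j Ej; rewrite mule_ge0// lee_fin ?(ltW (w_gt0 _))// orlicz_ge0// ltW.
- exact: measurable_funeM.
- exact: measurable_modular_integrand.
- move=> j Ej; rewrite lee_pmul2r ?lte_fin ?w_gt0//.
  apply: (@ext_oo_le _ _ l%:E) => //; first by rewrite lee_fin ltW.
  by apply: rearr_ge_fin => //; rewrite dl ltry.
Qed.

Lemma cvg_modular (u : nat -> T -> R) f :
  (forall n, mfun (u n)) -> mfun f ->
  (forall n, {ae mu, forall t, D t -> (`|u n t| <= `|f t|)%R}) ->
  {ae mu, forall t, D t -> u n t @[n --> \oo] --> (0 : R)%R} ->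
  rho f < +oo -> rho (u n) @[n --> \oo] --> 0.
Proof.
move=> mu_ mf uf u0 rf.
have := @dominated_convergence _ _ _ nu E mE
  (fun n j => ext_oo (EFin \o phi) (rearr (u n) j) * (w j)%:E) (cst 0)
  (fun j => ext_oo (EFin \o phi) (rearr f j) * (w j)%:E).
case.
- by move=> n; exact: measurable_modular_integrand.
- exact: measurable_cst.
- apply: filterS kappa_small => j Aj Ej; have [e e0 Ae] := Aj Ej.
  apply: cvge0_le => [n|b b0]; first exact: modular_integrand_ge0.
  (* For [c <= 1], convexity gives [phi c <= c * phi 1]; this choice then makes the integrand at [j]
     at most [b] once the rearrangement is at most [c]. *)
  pose c := Num.min 1%R (b / (phi 1 * w j))%R.
  have p1 : (0 < phi 1)%R by exact: orlicz_gt0.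
  have pw : (0 < phi 1 * w j)%R by rewrite mulr_gt0// w_gt0.
  have c0 : (0 < c)%R by rewrite lt_min ltr01 divr_gt0.
  have := cvg_level_mass mD c0 mu_ mf uf u0 (level_mass_lty mf c0 rf).
  move=> /fine_cvgP[dfin /cvgrPdist_lt/(_ _ e0)].
  apply: filterS2 dfin => n dfin /=.
  rewrite sub0r normrN -lte_fin => de.
  have {}de : distr (u n) c < e%:E.
    by rewrite -(fineK dfin) (le_lt_trans _ de)// lee_fin ler_norm.
  (* [kappa j] is 0 at the first term of a sequence, so masses tending to 0 need not by themselves
     get down to [kappa j]; [kappa_small] bridges this. *)
  have rc : rearr (u n) j <= c%:E.
    apply: rearr_le_fin => //; apply: Ae => //; first exact: measurable_level.
    by move=> t [].
  apply: (@le_trans _ _ ((phi c)%:E * (w j)%:E)).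
    rewrite lee_pmul2r ?lte_fin ?w_gt0//.
    by apply: (@ext_oo_le _ _ _ c%:E) => //; exact: rearr_ge0.
  have c1 : (c <= 1)%R by rewrite ge_min lexx.
  have cb : (c * (phi 1 * w j) <= b)%R.
    by rewrite -ler_pdivlMr// ge_min lexx orbT.
  have := orlicz_scale hphi ler01 (ltW c0) c1; rewrite mulr1 => pc.
  rewrite -EFinM lee_fin (le_trans _ cb)// mulrA ler_wpM2r// ltW// w_gt0//.
- apply/integrableP; split; first exact: measurable_modular_integrand.
  under eq_integral => j /set_mem Ej do rewrite gee0_abs ?modular_integrand_ge0//.
  exact: rf.
- apply: aeW => j n Ej; rewrite gee0_abs ?modular_integrand_ge0//.
  rewrite lee_pmul2r ?lte_fin ?w_gt0//.
  by apply: ext_oo_le => //; [exact: rearr_ge0|exact: rearr_le].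
- by move=> _ _; rewrite integral_cst// mul0e.
Qed.

(** * Bounded functions supported in a set of the exhaustion *)

Lemma rearr_eq0 f j : (forall l, (0 < l)%R -> distr f l <= (kappa j)%:E) ->
  rearr f j = 0.
Proof.
move=> fl; apply/eqP; rewrite eq_le rearr_ge0 andbT.
by apply/lee_addgt0Pr => e e0; rewrite add0e; exact: rearr_le_fin (fl _ e0).
Qed.

Lemma rearr_bounded f j (M : R) : E j -> (0 < M)%R ->
  (forall t, D t -> `|f t| <= M)%R -> rearr f j <= M%:E.
Proof.
move=> Ej M0 fM; apply: rearr_le_fin => //; rewrite /level_mass.
rewrite (_ : [set _ | _] = set0) ?measure0 ?lee_fin ?kappa_ge0//.
by apply/seteqP; split=> // t [/fM]; rewrite leNgt => /negP.
Qed.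

Lemma rearr_support f j n : mfun f ->
  (forall t, D t -> ~ D_ n t -> f t = 0%R) -> mu (D_ n) <= (kappa j)%:E ->
  rearr f j = 0.
Proof.
move=> mf f0 nj; apply: rearr_eq0 => l l0; apply: le_trans nj.
apply: le_measure; rewrite ?inE//; first exact: measurable_level.
move=> t [Dt lt]; apply: contrapT => /(f0 _ Dt) ft.
by move: lt; rewrite ft normr0 ltNge ltW.
Qed.

(** The integrand vanishes where [kappa j] reaches [mu (D_ n)], and elsewhere it is at most [M]
    times a weight of finite integral. [Phi] is general since both [phi] and its complementary
    function are needed. *)
Lemma modular_bounded_support Phi f n (M : R) : mfun f -> (0 < M)%R ->
  (forall u, (0 <= u)%R -> 0 <= Phi u) ->
  (forall u v, (0 <= u)%R -> (u <= v)%R -> Phi u <= Phi v) ->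
  Phi 0%R = 0 -> {in E, forall j, ext_oo Phi (rearr f j) <= M%:E} ->
  (forall t, D t -> ~ D_ n t -> f t = 0%R) ->
  modular Phi f < +oo.
Proof.
move=> mf M0 Phi_ge0 Phi_le Phi0 fM f0.
set F := fun j => ext_oo Phi (rearr f j) * (w j)%:E.
pose B := [set j | (kappa j)%:E < mu (D_ n)].
have mEB : measurable (E `&` B).
  have mk : measurable_fun E (EFin \o kappa) by exact/measurable_EFinP.
  exact: emeasurable_fun_infty_o.
have -> : modular Phi f = \int[nu]_(j in E `&` B) F j.
  rewrite integral_mkcondr; apply: eq_integral => j /set_mem Ej.
  rewrite patchE; case: ifPn => // /negP; rewrite inE /B/= => /negP.
  by rewrite -leNgt => /(rearr_support mf f0) ->; rewrite /= Phi0 mul0e.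
apply: (@le_lt_trans _ _ (\int[nu]_(j in E `&` B) (M%:E * (w j)%:E))).
  apply: ge0_le_integral => //.
  - by move=> j [Ej _]; exact: modular_integrand_ge0.
  - apply: (measurable_funS mE); [exact: subIsetl|].
    exact: measurable_modular_integrand.
  - apply: (measurable_funS mE); [exact: subIsetl|].
    exact: measurable_funeM.
  - move=> j [Ej _]; rewrite lee_pmul2r ?lte_fin ?w_gt0//.
    by apply: fM; rewrite inE.
rewrite ge0_integralZl//.
- by rewrite lte_mul_pinfty// ?lee_fin ?(ltW M0)//; exact: D_w.
- by apply: (measurable_funS mE) => //; exact: subIsetl.
- by move=> j [Ej _]; rewrite lee_fin ltW// w_gt0.
- by rewrite lee_fin ltW.
Qed.

(** * The equality case of Young's inequality for rearrangements *)

Local Notation p := (subgradient phi).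

Lemma mfun_subgradient f : mfun f -> mfun (fun t => p `|f t|%R).
Proof.
move=> mf; apply: (measurableT_comp (f := p) (g := fun t => `|f t|%R)).
  by apply: nondecreasing_measurable => //; exact: subgradient_le.
exact: measurableT_comp.
Qed.

(** Monotonicity of [p] only locates the rearrangement [v] of [p(|f|)] between the values of [p]
    just below and just above [u]. The subgradient inequality for [v] follows by letting points [y]
    between [x] and [u] tend to [u]. *)
Lemma rearr_subgradient f j (u : R) : mfun f -> rearr f j = u%:E ->
  exists v : R, rearr (fun t => p `|f t|%R) j = v%:E /\
    (forall x, 0 <= x -> v * (x - u) <= phi x - phi u)%R.
Proof.
move=> mf fu; set g := (fun t : T => p `|f t|%R).
have mg : mfun g by exact: mfun_subgradient.
have g0 t : (0 <= g t)%R by exact: subgradient_ge0.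
have u0 : (0 <= u)%R by have := rearr_ge0 mu D kappa f j; rewrite fu lee_fin.
have g_le y : (u < y)%R -> rearr g j <= (p y)%:E.
  move=> uy; have y0 := le_lt_trans u0 uy.
  apply/lee_addgt0Pr => e e0; rewrite -EFinD; apply: rearr_le_fin.
    by rewrite ltr_wpDl// subgradient_ge0.
  apply: (@le_trans _ _ (distr f y)); last first.
    by apply: rearr_lt => //; rewrite fu lte_fin.
  apply: le_measure; rewrite ?inE; [exact: measurable_level..|].
  move=> t [Dt]; rewrite ger0_norm//= => pt; split => //.
  rewrite ltNge; apply/negP => /(subgradient_le hphi) pf.
  by move: pt; rewrite ltNge (le_trans pf)// lerDl ltW.
have [v gv] : exists v, rearr g j = v%:E.
  have := g_le (u + 1)%R; rewrite ltrDl ltr01 => /(_ isT).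
  have := rearr_ge0 mu D kappa g j; case: rearr => // v _ _; by exists v.
have v0 : (0 <= v)%R by have := rearr_ge0 mu D kappa g j; rewrite gv lee_fin.
have {}g_le y : (u < y)%R -> (v <= p y)%R.
  by move=> /g_le; rewrite gv lee_fin.
have g_ge y : (0 <= y)%R -> (y < u)%R -> (p y <= v)%R.
  rewrite le_eqVlt => /predU1P[<- _|y0 yu]; first by rewrite subgradient_npos.
  rewrite leNgt; apply/negP => vp.
  (* Level sets are defined by a strict inequality, so a level strictly below [p y] is required; the
     midpoint still exceeds [v]. *)
  suff : ((v + p y) / 2)%:E <= rearr g j by rewrite gv lee_fin; lra.
  apply: rearr_ge_fin => //; apply: (@lt_le_trans _ _ (distr f y)).
    by apply: rearr_gt => //; rewrite fu lte_fin.
  apply: le_measure; rewrite ?inE; [exact: measurable_level..|].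
  move=> t [Dt yt]; split => //; rewrite ger0_norm//.
  apply: (@lt_le_trans _ _ (p y)); first by lra.
  by apply: subgradient_le => //; exact: ltW.
exists v; split=> // x x0; have [xu|ux|->] := ltgtP x u; last by rewrite !subrr mulr0.
- apply: (@slack_le _ _ _ (p u * (u - x))%R) => e e0 e1.
  (* The error made by replacing [phi u] with [phi y] is controlled by the subgradient [p u], and is
     proportional to [e]. *)
  pose y := (u - e * (u - x))%R.
  have yx : (0 <= y - x)%R by rewrite /y; nra.
  have yu : (y < u)%R by rewrite /y; nra.
  have y0 : (0 <= y)%R by lra.
  have h1 := subgradientP hphi y0 x0.
  have h2 := subgradientP hphi u0 y0.
  have h3 : (p y * (y - x) <= v * (y - x))%R by rewrite ler_wpM2r// g_ge.
  have h4 : (v * (y - x) <= v * (u - x))%R by rewrite ler_wpM2l//; lra.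
  have -> : (e * (p u * (u - x)) = - (p u * (y - u)))%R by rewrite /y; ring.
  lra.
- apply: (@slack_le _ _ _ (v * (x - u))%R) => e e0 e1.
  (* To the right of [u], monotonicity of [phi] replaces [phi y] by [phi u] at no cost; the only
     error is [v * (y - u)]. *)
  pose y := (u + e * (x - u))%R.
  have yx : (0 <= x - y)%R by rewrite /y; nra.
  have yu : (u < y)%R by rewrite /y; nra.
  have y0 : (0 <= y)%R by lra.
  have h1 := subgradientP hphi y0 x0.
  have h2 : (phi u <= phi y)%R by apply: orlicz_le => //; exact: ltW.
  have h3 : (v * (x - y) <= p y * (x - y))%R by rewrite ler_wpM2r// g_le.
  have -> : (e * (v * (x - u)) = v * (y - u))%R by rewrite /y; ring.
  lra.
Qed.

Lemma pairing_young f g : pairing f g <= rho f + rho_star g.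
Proof.
rewrite -ge0_integralD//; last 4 first.
- by move=> j; exact: modular_integrand_ge0.
- exact: measurable_modular_integrand.
- by move=> j; exact: modular_integrand_ge0.
- exact: measurable_modular_integrand.
apply: ge0_le_integral => //.
- by move=> j; exact: pairing_integrand_ge0.
- exact: measurable_pairing_integrand.
- by apply: emeasurable_funD; exact: measurable_modular_integrand.
- move=> j Ej; rewrite -muleDl//; last first.
    by apply: ge0_adde_def; rewrite inE; apply: ext_oo_ge0 => //; exact: rearr_ge0.
  rewrite lee_pmul2r ?lte_fin ?w_gt0//.
  have := rearr_ge0 mu D kappa f j; have := rearr_ge0 mu D kappa g j.
  case: (rearr f j) => [u| |]; case: (rearr g j) => [v| |]//= v0 u0.
  + by apply: young; rewrite -lee_fin.
  + by rewrite addey ?leey.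
  + by rewrite addye ?leey// gt_eqF// (lt_le_trans (ltNyr 0))// phis_ge0.
Qed.

(* [g = p(|f|)] realizes equality in Young's inequality: its rearrangement is a
   subgradient of [phi] at the rearrangement of [f], even where it differs from
   [p] of it (at the jumps of [p]). *)
Lemma pairing_young_eq f n (M : R) : mfun f -> (0 < M)%R ->
  (forall t, D t -> `|f t| <= M)%R ->
  (forall t, D t -> ~ D_ n t -> f t = 0%R) ->
  pairing f (fun t => p `|f t|)%R = rho f + rho_star (fun t => p `|f t|)%R /\
  rho_star (fun t => p `|f t|)%R < +oo.
Proof.
move=> mf M0 fM f0; set g := (fun t : T => p `|f t|%R).
have mg : mfun g by exact: mfun_subgradient.
have key j : E j -> exists u v : R, [/\ rearr f j = u%:E, rearr g j = v%:E,
    (0 <= u <= M)%R, (0 <= v <= p M)%R & complementary phi v = (u * v - phi u)%:E].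
  move=> Ej; have := rearr_bounded Ej M0 fM.
  have := rearr_ge0 mu D kappa f j.
  case fu : (rearr f j) => [u| |]//; rewrite !lee_fin => u0 uM.
  have [v [gv uv]] := rearr_subgradient mf fu.
  exists u, v; split => //; first by rewrite u0.
    have := rearr_ge0 mu D kappa g j; rewrite gv lee_fin => -> /=.
    apply/ler_addgt0Pr => e e0.
    have : rearr g j <= (p M + e)%:E; last by rewrite gv lee_fin.
    apply: rearr_bounded => //; first by rewrite ltr_wpDl// subgradient_ge0.
    move=> t Dt; rewrite ger0_norm ?subgradient_ge0// ler_wpDr// ?(ltW e0)//.
    by apply: (subgradient_le hphi); exact: fM.
  exact: young_eq.
split.
  rewrite -ge0_integralD//; last 4 first.
  - by move=> j; exact: modular_integrand_ge0.
  - exact: measurable_modular_integrand.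
  - by move=> j; exact: modular_integrand_ge0.
  - exact: measurable_modular_integrand.
  apply: eq_integral => j /set_mem /key[u [v [-> -> u0 v0 /= ->]]].
  by rewrite -!EFinM -EFinD; congr (_%:E); ring.
(* Equality in Young's inequality bounds the complementary function by [u * v <= M * p M]; the added
   1 only makes the bound positive. *)
apply: (@modular_bounded_support _ _ n (M * p M + 1)) => //.
- by rewrite ltr_wpDl// mulr_ge0 ?subgradient_ge0// ltW.
- exact: complementary0.
- move=> j /set_mem /key[u [v [_ -> /andP[u0 uM] /andP[v0 vM] /= ->]]].
  rewrite lee_fin; have : (u * v <= M * p M)%R by rewrite ler_pM.
  by have := orlicz_ge0 hphi u0; lra.
- by move=> t Dt /(f0 _ Dt) ft; rewrite /g ft normr0 subgradient_npos.
Qed.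

(** * Comparison of the Orlicz and Luxemburg norms *)

Lemma modular0 Phi : Phi 0%R = 0 -> modular Phi (cst 0%R) = 0.
Proof.
move=> Phi0; apply: integral0_eq => j Ej; rewrite rearr_eq0 /= ?Phi0 ?mul0e//.
move=> l l0; rewrite /level_mass (_ : [set _ | _] = set0) ?measure0 ?lee_fin ?kappa_ge0//.
by apply/seteqP; split=> // t [_] /=; rewrite normr0 ltNge ltW.
Qed.

Lemma orlicz_norm_ub f g : mfun g -> rho_star g <= 1 -> pairing f g <= orl f.
Proof. by move=> mg g1; apply: ereal_sup_ubound; exists g. Qed.

Lemma orlicz_norm_ge0 f : 0 <= orl f.
Proof.
rewrite (le_trans (pairing_ge0 f (cst 0%R)))// orlicz_norm_ub//.
by rewrite modular0 ?lee_fin// complementary0.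
Qed.

Lemma orlicz_norm_le1D f : orl f <= 1 + rho f.
Proof.
apply: ge_ereal_sup => _ [g [mg g1] <-].
by rewrite (le_trans (pairing_young f g))// addeC leeD2r.
Qed.

Lemma orlicz_norm_le f g : mfun f -> mfun g ->
  {ae mu, forall t, D t -> (`|f t| <= `|g t|)%R} -> orl f <= orl g.
Proof.
move=> mf mg fg; apply: ge_ereal_sup => _ [h [mh h1] <-].
by rewrite (le_trans (pairing_le h mf mg fg))// orlicz_norm_ub.
Qed.

Lemma orlicz_normZ f c : (0 < c)%R -> orl (fun t => c * f t)%R <= c%:E * orl f.
Proof.
move=> c0; apply: ge_ereal_sup => _ [g [mg g1] <-].
by rewrite pairingZl// lee_pmul2l ?lte_fin// orlicz_norm_ub.
Qed.

Lemma luxemburg_norm_ge0 f : 0 <= lux f.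
Proof.
by apply: le_ereal_inf_tmp => _ [e [/ltW e0 _] <-]; rewrite lee_fin.
Qed.

Lemma luxemburg_norm_le f g : mfun f -> mfun g ->
  {ae mu, forall t, D t -> (`|f t| <= `|g t|)%R} -> lux f <= lux g.
Proof.
move=> mf mg fg; apply: ereal_inf_le_tmp => _ [e [e0 ge] <-].
exists e; [split; [exact: e0|]|exact: erefl].
apply: le_trans ge; apply: modular_le; [exact: phi_ge0|exact: phi_le|exact: mfunV..|].
by apply: filterS fg => t /[apply] fg; rewrite !normrM ler_wpM2r.
Qed.

(** For every admissible scale [e], the function [f / e] has modular at most 1, hence Orlicz norm at
    most [1 + 1]. *)
Lemma orlicz_norm_le2 f : orl f <= 2%:E * lux f.
Proof.
rewrite -lee_pdivrMl//; apply: le_ereal_inf_tmp => _ [e [e0 fe] <-].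
rewrite lee_pdivrMl// -EFinM.
have -> : f = (fun t => e * (f t / e))%R.
  by apply/funext => t; rewrite mulrC divfK// gt_eqF.
rewrite (le_trans (orlicz_normZ _ e0))// mulrC EFinM lee_pmul2l ?lte_fin//.
rewrite (le_trans (orlicz_norm_le1D _))// [leRHS](_ : _ = 1 + 1) ?leeD2l//.
Qed.

(** * The modular space, order-continuous elements and truncations *)

Lemma modular_space_fin f : mfun f -> rho f < +oo -> X f.
Proof.
move=> mf rf; split; first exact: mf.
by exists 1%R; [exact: ltr01|under eq_fun do rewrite mul1r].
Qed.

Lemma modular_spaceZ f c : X f -> X (fun t => c * f t)%R.
Proof.
move=> [mf [l l0 fl]]; have [->|c0] := eqVneq c 0%R.
  apply: modular_space_fin; first exact: mfunZ.
  by under eq_fun do rewrite mul0r; rewrite modular0//= orlicz0.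
split; first exact: mfunZ.
exists (l / `|c|)%R; first by rewrite divr_gt0// normr_gt0.
rewrite (@eq_modular _ _ (fun t => l * f t)%R)// => t _.
rewrite !normrM normfV normr_id -!mulrA [X in (_ * X)%R]mulrA mulVf ?mul1r//.
by rewrite normr_eq0.
Qed.

(** For each [e > 0], finiteness of the modular of [f / e] makes the modulars of [u n / e] tend to
    0; as soon as they are at most 1, the Luxemburg norm of [u n] is at most [e]. *)
Lemma order_continuous_modular f : mfun f ->
  (forall l, (0 < l)%R -> rho (fun t => l * f t)%R < +oo) ->
  order_continuous mu D X lux f.
Proof.
move=> mf fl; split; first by split => //; exists 1%R => //; exact: fl.
move=> u Xu uf u_anti u0; have mu_ n : mfun (u n) by case: (Xu n).
have uf' n : {ae mu, forall t, D t -> (`|u n t| <= `|f t|)%R}.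
  by apply: filterS (uf n) => t /[apply] /andP[un0 unf]; rewrite ger0_norm.
split.
  apply/nonincreasing_seqP => n; apply: luxemburg_norm_le => //.
  apply: filterS2 (u_anti n) (uf n.+1) => t h1 h2 Dt.
  have /andP[h3 _] := h2 Dt; have h4 := h1 Dt.
  by rewrite !ger0_norm// (le_trans h3).
apply: cvge0_le => [n|e e0]; first exact: luxemburg_norm_ge0.
have := @cvg_modular (fun n t => u n t / e)%R (fun t => e^-1 * f t)%R.
have h1 n : mfun (fun t => u n t / e)%R by exact: mfunV.
have h2 n : {ae mu, forall t, D t -> (`|u n t / e| <= `|e^-1 * f t|)%R}.
  apply: filterS (uf' n) => t /[apply] h.
  by rewrite !normrM mulrC ler_wpM2l.
have h3 : {ae mu, forall t, D t -> (u n t / e)%R @[n --> \oo] --> (0 : R)%R}.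
  by apply: filterS u0 => t /[apply] h; rewrite -(mul0r e^-1%R); exact: cvgMl.
have eV : (0 < e^-1)%R by rewrite invr_gt0.
move=> /(_ h1 (mfunZ _ mf) h2 h3 (fl _ eV)) /fine_cvgP[rfin].
move=> /cvgrPdist_lt/(_ _ ltr01).
apply: filterS2 rfin => n rfin /=; rewrite sub0r normrN => r1.
apply: ereal_inf_lbound; exists e => //; split => //.
by rewrite -(fineK rfin) lee_fin (le_trans (ler_norm _))// ltW.
Qed.

Lemma order_continuous_orlicz f :
  order_continuous mu D X lux f -> order_continuous mu D X orl f.
Proof.
move=> [Xf h]; split => // u Xu uf u_anti u0.
have [_ lu0] := h u Xu uf u_anti u0.
have mu_ n : mfun (u n) by case: (Xu n).
split.
  apply/nonincreasing_seqP => n; apply: orlicz_norm_le => //.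
  apply: filterS2 (u_anti n) (uf n.+1) => t h1 h2 Dt.
  have /andP[h3 _] := h2 Dt; have h4 := h1 Dt.
  by rewrite !ger0_norm// (le_trans h3).
apply: (@squeeze_cvge _ _ _ _ (cst 0) _ (fun n => 2%:E * lux (u n))).
- by apply: nearW => n; rewrite orlicz_norm_ge0 orlicz_norm_le2.
- exact: cvg_cst.
- by rewrite -(mule0 2%:E); apply: cvgeZl.
Qed.

(** Large values are replaced by 0 rather than capped: the truncation and the remainder are each
    either [f t] or 0, hence both dominated by [|f|]. *)
Definition trunc n f : T -> R :=
  fun t => (f t * \1_(D_ n `&` [set t | (`|f t| <= n%:R)%R]) t)%R.

Lemma trunc_in n f t : D_ n t -> (`|f t| <= n%:R)%R -> trunc n f t = f t.
Proof. by move=> nt fn; rewrite /trunc indicE mem_set ?mulr1. Qed.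

Lemma trunc_out n f t : ~ (D_ n t /\ (`|f t| <= n%:R)%R) -> trunc n f t = 0%R.
Proof. by move=> nt; rewrite /trunc indicE memNset ?mulr0. Qed.

Lemma trunc_le n f t : (`|trunc n f t| <= `|f t|)%R.
Proof.
have [[nt fn]|h] := pselect (D_ n t /\ (`|f t| <= n%:R)%R).
  by rewrite trunc_in.
by rewrite trunc_out// normr0.
Qed.

Lemma trunc_mono n k f t : (n <= k)%N -> (`|trunc n f t| <= `|trunc k f t|)%R.
Proof.
move=> nk; have [[nt fn]|h] := pselect (D_ n t /\ (`|f t| <= n%:R)%R).
  rewrite !trunc_in//; first exact: D_le nt.
  by rewrite (le_trans fn)// ler_nat.
by rewrite [X in (`|X| <= _)%R]trunc_out// normr0.
Qed.

Lemma trunc_bounded n f t : (`|trunc n f t| <= n.+1%:R)%R.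
Proof.
have [[nt fn]|h] := pselect (D_ n t /\ (`|f t| <= n%:R)%R).
  by rewrite trunc_in// (le_trans fn)// ler_nat.
by rewrite trunc_out// normr0.
Qed.

Lemma trunc_near f t : D t -> \forall n \near \oo, trunc n f t = f t.
Proof.
move=> /D_cover[k kt]; near=> n; apply: trunc_in.
  by apply: D_le kt; near: n; exact: nbhs_infty_ge.
by near: n; exact: nbhs_infty_ger.
Unshelve. all: end_near. Qed.

Lemma measurable_trunc_set n f : mfun f ->
  measurable (D_ n `&` [set t | (`|f t| <= n%:R)%R]).
Proof.
move=> mf; have := measurable_level mD n%:R mf.
move=> /(measurableD (mD_ n)); congr measurable; apply/seteqP; split=> t /= [nt].
  by move=> h; split => //; rewrite leNgt; apply/negP => ft; apply: h; split => //; exact: D_D nt.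
by move=> h; split => // -[_]; rewrite ltNge h.
Qed.

Lemma mfun_trunc n f : mfun f -> mfun (trunc n f).
Proof.
move=> mf; apply: measurable_funM => //.
by apply: measurable_indic; exact: measurable_trunc_set.
Qed.

Lemma trunc_order_continuous n f : mfun f ->
  order_continuous mu D X lux (trunc n f).
Proof.
move=> mf; apply: order_continuous_modular; first exact: mfun_trunc.
move=> l l0; have ml : (0 < l * n.+1%:R)%R by rewrite mulr_gt0.
apply: (@modular_bounded_support _ _ n (phi (l * n.+1%:R))) => //.
- by apply: mfunZ; exact: mfun_trunc.
- exact: orlicz_gt0.
- by rewrite /= orlicz0.
- move=> j /set_mem Ej.
  apply: (@ext_oo_le _ (EFin \o phi) _ (l * n.+1%:R)%:E) => //.
    exact: rearr_ge0.
  apply: rearr_bounded => // t Dt.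
  by rewrite normrM gtr0_norm// ler_wpM2l ?(ltW l0)// trunc_bounded.
- by move=> t Dt nt; rewrite trunc_out ?mulr0// => -[].
Qed.

(** * The Orlicz unit ball lies in the Luxemburg unit ball *)

(** With [g = p(|f|)] and [k = rho_star g], the pairing of [f] and [g] is [rho f + k]. If [k <= 1],
    then [g] is admissible and [rho f + k <= 1]. If [k > 1], then [g / k] is admissible and
    [(rho f + k) / k <= 1], which forces [rho f <= 0]. *)
Lemma modular_le1_bounded f n (M : R) : mfun f -> (0 < M)%R ->
  (forall t, D t -> `|f t| <= M)%R ->
  (forall t, D t -> ~ D_ n t -> f t = 0%R) -> orl f <= 1 -> rho f <= 1.
Proof.
move=> mf M0 fM f0 f1; have [fg gfin] := pairing_young_eq mf M0 fM f0.
set g := (fun t : T => _) in fg gfin.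
have mg : mfun g by exact: mfun_subgradient.
have g0 : 0 <= rho_star g by exact: modular_ge0.
have [g1|g1] := leP (rho_star g) 1.
  by rewrite (le_trans _ f1)// (le_trans _ (orlicz_norm_ub f mg g1))// fg leeDl.
have gE : rho_star g = (fine (rho_star g))%:E.
  by rewrite fineK// ge0_fin_numE.
set k := fine (rho_star g) in gE.
have k1 : (1 < k)%R by rewrite -lte_fin -gE.
have k0 : (0 < k)%R by lra.
have kV : (0 < k^-1)%R by rewrite invr_gt0.
have gk : rho_star (fun t => k^-1 * g t)%R <= 1.
  apply: (@le_trans _ _ (k^-1%:E * rho_star g)).
    rewrite -ge0_integralZl//; last 3 first.
    - exact: measurable_modular_integrand.
    - by move=> j; exact: modular_integrand_ge0.
    - by rewrite lee_fin ltW.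
    apply: ge0_le_integral => //.
    - by move=> j; exact: modular_integrand_ge0.
    - exact: measurable_modular_integrand.
    - by apply: measurable_funeM; exact: measurable_modular_integrand.
    - move=> j Ej; rewrite muleA lee_pmul2r ?lte_fin ?w_gt0// rearrZ//.
      have := rearr_ge0 mu D kappa g j; case: (rearr g j) => [v| |]// v0.
        by rewrite -EFinM /= mulrC complementary_div// ltW.
      by rewrite gt0_muley ?lte_fin//= gt0_muley ?lte_fin.
  by rewrite gE -EFinM mulVf ?gt_eqF.
have := orlicz_norm_ub f (mfunZ _ mg) gk.
rewrite pairingC (pairingZl _ _ kV) pairingC fg => h.
have {h} := le_trans h f1; rewrite (lee_pdivrMl _ _ k0) mule1 gE.
rewrite -[leRHS]add0e leeD2rE; last exact: isT.
by move=> h; exact: (le_trans h lee01).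
Qed.

(** The level sets of the truncations increase to that of [f]; by continuity of [mu] from below,
    some of them must already have mass above [kappa j]. *)
Lemma trunc_rearr f j l : mfun f -> (0 < l)%R -> l%:E < rearr f j ->
  exists n, l%:E <= rearr (trunc n f) j.
Proof.
move=> mf l0 lf; apply: contrapT => /forallNP h.
have dn n : distr (trunc n f) l <= (kappa j)%:E.
  rewrite leNgt; apply/negP => /(rearr_ge_fin mD (mfun_trunc n mf)); exact: h.
have := rearr_gt l0 lf; rewrite ltNge => /negP; apply.
pose F n := [set t | D t /\ (l < `|trunc n f t|)%R].
have mF n : measurable (F n) by apply: measurable_level => //; exact: mfun_trunc.
have FE : \bigcup_n F n = [set t | D t /\ (l < `|f t|)%R].
  apply/seteqP; split=> t.
    move=> [n _ [Dt nt]]; split => //.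
    exact: lt_le_trans (trunc_le n f t).
  move=> [Dt ft]; have [N _ h'] := trunc_near f Dt.
  by exists N => //; split => //; rewrite h'//=.
rewrite /level_mass -FE.
have Fnd : nondecreasing_seq F.
  move=> n k nk; apply/subsetPset => t [Dt nt]; split => //.
  exact: lt_le_trans (trunc_mono _ _ nk).
have mUF : measurable (\bigcup_n F n) by exact: bigcupT_measurable.
have Fcvg : (mu \o F) x @[x --> \oo] --> mu (\bigcup_n F n).
  exact: nondecreasing_cvg_mu.
rewrite -(cvg_lim _ Fcvg)//; apply: lime_le.
  by apply/cvg_ex; eexists; exact: Fcvg.
by apply: nearW => n; exact: dn.
Qed.

Lemma luxemburg_norm_le1 f : mfun f -> orl f <= 1 -> lux f <= 1.
Proof.
move=> mf f1; apply/lee_addgt0Pr => e e0; rewrite -EFinD.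
have e1 : (0 < 1 + e)%R by lra.
apply: ereal_inf_lbound; exists (1 + e)%R; [split; [exact: e1|]|exact: erefl].
have tn1 n : rho (trunc n f) <= 1.
  apply: (@modular_le1_bounded _ n n.+1%:R).
  - exact: mfun_trunc.
  - exact: ltr0Sn.
  - by move=> t _; exact: trunc_bounded.
  - by move=> t Dt nt; apply: trunc_out => -[].
  - apply: le_trans f1; apply: orlicz_norm_le; [exact: mfun_trunc|exact: mf|].
    by apply: aeW => t _; exact: trunc_le.
pose G n j := ext_oo (EFin \o phi) (rearr (trunc n f) j) * (w j)%:E.
have Gnd j : E j -> nondecreasing_seq (G ^~ j).
  move=> Ej n k nk; rewrite /G lee_pmul2r ?lte_fin ?w_gt0//.
  apply: ext_oo_le; [exact: phi_le|exact: rearr_ge0|].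
  apply: rearr_le; [exact: mD|exact: mfun_trunc..|].
  by apply: aeW => t _; exact: trunc_mono.
have mG n : measurable_fun E (G n) by exact: measurable_modular_integrand.
have G0 n j : E j -> 0 <= G n j by exact: modular_integrand_ge0.
have := @monotone_convergence _ _ _ nu E mE G mG G0 Gnd.
move=> intG; apply: (@le_trans _ _ (\int[nu]_(j in E) limn (G ^~ j))); last first.
  rewrite intG; apply: lime_le; last by apply: nearW => n; exact: tn1.
  apply: ereal_nondecreasing_is_cvgn => n k nk.
  by apply: ge0_le_integral => // [j|j Ej]; [exact: G0|exact: Gnd].
apply: ge0_le_integral => //.
- by move=> j; exact: modular_integrand_ge0.
- exact: measurable_modular_integrand.
- by apply: (emeasurable_fun_cvg G) => // j Ej; exact: ereal_nondecreasing_is_cvgn (Gnd _ Ej).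
move=> j Ej.
have Gcvg : cvgn (G ^~ j) by exact: ereal_nondecreasing_is_cvgn (Gnd _ Ej).
have G_lim n : G n j <= limn (G ^~ j).
  rewrite (cvg_lim _ (ereal_nondecreasing_cvgn (Gnd _ Ej)))//.
  by apply: ereal_sup_ubound; exists n.
have fE : rearr (fun t => f t / (1 + e))%R j = ((1 + e)^-1)%:E * rearr f j.
  by rewrite -rearrZ ?invr_gt0//; congr rearr; apply/funext => t; rewrite mulrC.
have bnd l : (0 < l)%R -> l%:E < rearr f j ->
    (phi l)%:E * (w j)%:E <= limn (G ^~ j).
  move=> l0 /(trunc_rearr mf l0)[n ln]; apply: le_trans (G_lim n).
  rewrite /G lee_pmul2r ?lte_fin ?w_gt0//.
  by apply: (@ext_oo_le _ (EFin \o phi) l%:E) => //; rewrite lee_fin ltW.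
rewrite fE; have := rearr_ge0 mu D kappa f j.
case fj : (rearr f j) => [r| |]// r0.
  rewrite -EFinM /=; move: r0; rewrite lee_fin le_eqVlt => /predU1P[<-|r0].
    by rewrite mulr0 orlicz0// mul0r (le_trans (G0 0%N j Ej)).
  (* Here the factor [1 + e] is used: [r / (1 + e)] lies strictly below [r], as [bnd] demands. *)
  rewrite EFinM; apply: bnd; first by rewrite mulr_gt0// invr_gt0.
  by rewrite fj lte_fin ltr_pdivrMl// ltr_pMl//; lra.
suff -> : limn (G ^~ j) = +oo by rewrite leey.
apply/eqyP => A A0.
have w0 := w_gt0 Ej; have p1 : (0 < phi 1)%R by exact: orlicz_gt0.
(* Beyond 1, convexity makes [phi] grow at least linearly, [phi l >= l * phi 1]; the quotient makes
   the bound exceed [A] and the summand 1 ensures [l >= 1]. *)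
pose l := (1 + A / (phi 1 * w j))%R.
have Apw : (0 < A / (phi 1 * w j))%R by rewrite divr_gt0// mulr_gt0.
have l0 : (0 < l)%R by rewrite /l; lra.
apply: le_trans (bnd l l0 _); last by rewrite fj ltry.
have lV : (l^-1 <= 1)%R by rewrite invf_le1// /l; lra.
have := orlicz_scale hphi (ltW l0) _ lV.
rewrite mulVf ?gt_eqF// invr_ge0 => /(_ (ltW l0)); rewrite ler_pdivlMl// => pl.
rewrite -EFinM lee_fin; apply: (@le_trans _ _ (l * phi 1 * w j)%R).
  rewrite -mulrA -ler_pdivrMr ?mulr_gt0// /l; lra.
by rewrite ler_wpM2r// ltW.
Qed.

(** * Singular functionals *)

Section singular.
Variable S : (T -> R) -> R.
Hypothesis S_lin : forall c f g, X f -> X g ->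
  S (fun t => c * f t + g t)%R = (c * S f + S g)%R.
Hypothesis S_oc : forall f, order_continuous mu D X lux f -> S f = 0%R.

Local Notation sup_modular :=
  (ereal_sup [set (S f)%:E | f in [set f | mfun f /\ rho f < +oo]]).

Let rho0 : rho (cst 0%R) = 0.
Proof. by rewrite modular0//= orlicz0. Qed.

Let X0 : X (cst 0%R).
Proof. by apply: modular_space_fin; [exact: measurable_cst|rewrite rho0]. Qed.

Lemma singular0 : S (cst 0%R) = 0%R.
Proof.
have := S_lin 1 X0 X0; rewrite (_ : (fun t => _) = cst 0%R); first by lra.
by apply/funext => t; rewrite mulr0 addr0.
Qed.

Lemma singularZ f c : X f -> S (fun t => c * f t)%R = (c * S f)%R.
Proof.
move=> Xf; have := S_lin c Xf X0; rewrite singular0 addr0 => <-.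
by congr S; apply/funext => t; rewrite addr0.
Qed.

Lemma singular_le_sup f : mfun f -> rho f < +oo -> `|S f|%:E <= sup_modular.
Proof.
move=> mf rf; have Xf := modular_space_fin mf rf.
have [S0|S0] := leP 0%R (S f).
  by rewrite ger0_norm//; apply: ereal_sup_ubound; exists f.
rewrite ltr0_norm// -mulN1r -singularZ//; apply: ereal_sup_ubound.
exists (fun t => -1 * f t)%R; [split; [exact: mfunZ|]|exact: erefl].
by rewrite (@eq_modular _ _ f)// => t _; rewrite mulN1r normrN.
Qed.

Lemma sup_modular_ge0 : 0 <= sup_modular.
Proof.
apply: ereal_sup_ubound; exists (cst 0%R); last by rewrite singular0.
by split; [exact: measurable_cst|rewrite rho0].
Qed.

Lemma singular_le_scale f l : X f -> (0 < l)%R ->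
  rho (fun t => f t / l)%R < +oo -> `|S f|%:E <= l%:E * sup_modular.
Proof.
move=> Xf l0 rf; have mf : mfun f by case: Xf.
have mfl : mfun (fun t => f t / l)%R by exact: mfunV.
have -> : f = (fun t => l * (f t / l))%R.
  by apply/funext => t; rewrite mulrC divfK// gt_eqF.
rewrite singularZ; last exact: modular_space_fin.
rewrite normrM gtr0_norm// EFinM lee_pmul2l ?lte_fin//.
exact: singular_le_sup.
Qed.

(* Truncations of [f] are order continuous and hence invisible to [S], while
   the modular of the remainder tends to 0. *)
Lemma singular_small_modular f e : mfun f -> rho f < +oo -> (0 < e)%R ->
  exists g, [/\ mfun g, rho g <= e%:E & S f = S g].
Proof.
move=> mf rf e0; pose g n := (fun t => f t - trunc n f t)%R.
have mg n : mfun (g n) by apply: measurable_funB => //; exact: mfun_trunc.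
have gf n t : (`|g n t| <= `|f t|)%R.
  rewrite /g; have [[nt fn]|h] := pselect (D_ n t /\ (`|f t| <= n%:R)%R).
    by rewrite trunc_in// subrr normr0.
  by rewrite trunc_out// subr0.
have := cvg_modular mg mf.
move=> /(_ (fun n => aeW _ (fun t _ => gf n t)) _ rf).
have g0 : {ae mu, forall t, D t -> g n t @[n --> \oo] --> (0 : R)%R}.
  apply: aeW => t Dt; apply: cvg_near_cst.
  by apply: filterS (trunc_near f Dt) => n; rewrite /g => ->; rewrite subrr.
move=> /(_ g0) /fine_cvgP[rfin] /cvgrPdist_lt/(_ _ e0) re.
have [n [rn]] := filter_ex (filterI rfin re).
rewrite /= sub0r normrN => ne; exists (g n).
have gne : rho (g n) <= e%:E.
  by rewrite -(fineK rn) lee_fin (le_trans (ler_norm _))// ltW.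
split; [exact: mg|exact: gne|].
have Xg : X (g n).
  by apply: modular_space_fin; [exact: mg|rewrite (le_lt_trans gne)// ltry].
have oct := trunc_order_continuous n mf.
have Xt : X (trunc n f) by case: oct.
have := S_lin 1 Xg Xt; rewrite (S_oc oct) mul1r addr0 => <-.
by congr S; apply/funext => t; rewrite mul1r /g subrK.
Qed.

(** If the infimum were 0, arbitrarily small scales would be admissible, so every multiple of [f]
    would have finite modular and [f] would be order continuous. *)
Lemma theta_gt0 f : X f -> ~ order_continuous mu D X lux f -> 0 < theta rho f.
Proof.
move=> Xf noc; have mf : mfun f by case: Xf.
rewrite ltNge; apply/negP => f0; apply: noc.
apply: order_continuous_modular => // l l0.
have lV : (0 < l^-1)%R by rewrite invr_gt0.
have /ereal_inf_lt[_ [k [k0 fk] <-]] : theta rho f < (l^-1)%:E.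
  by rewrite (le_lt_trans f0)// lte_fin.
rewrite lte_fin => kl; apply: le_lt_trans fk.
apply: modular_le; [exact: phi_ge0|exact: phi_le|exact: mfunZ|exact: mfunV|].
apply: aeW => t _; rewrite !normrM mulrC ler_wpM2l//.
rewrite !gtr0_norm ?invr_gt0// -(invrK l) lef_pV2 ?posrE//; exact: ltW.
Qed.

Lemma theta_lty f : X f -> theta rho f < +oo.
Proof.
move=> [mf [l l0 fl]]; apply: (@le_lt_trans _ _ (l^-1)%:E); last exact: ltry.
apply: ereal_inf_lbound; exists (l^-1)%R; [split; [by rewrite invr_gt0|]|exact: erefl].
by under eq_fun do rewrite invrK mulrC.
Qed.

Lemma singular_dual_norms :
  [/\ dual_norm X lux S = dual_norm X orl S,
      dual_norm X orl S = sup_modular &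
      sup_modular = sup_or0 [set (S f / fine (theta rho f))%:E | f in
        X `\` order_continuous mu D X lux]].
Proof.
(* [orl_lux], [lux_sup] and [sup_orl] form a cycle of inequalities that identifies the first three
   quantities. *)
have orl_lux : dual_norm X orl S <= dual_norm X lux S.
  apply: ereal_sup_le => _ [f [Xf f1] <-]; exists f; [split|exact: erefl].
    exact: Xf.
  by apply: luxemburg_norm_le1; [case: Xf|exact: f1].
have lux_sup : dual_norm X lux S <= sup_modular.
  apply: ge_ereal_sup => _ [f [Xf f1] <-].
  apply: (lee_scale_gt1 sup_modular_ge0) => e e0.
  have /ereal_inf_lt[_ [k [k0 fk] <-]] : lux f < (1 + e)%:E.
    by rewrite (le_lt_trans f1)// lte_fin; lra.
  rewrite lte_fin => ke.
  apply: (@le_trans _ _ (k%:E * sup_modular)).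
    by apply: singular_le_scale => //; rewrite (le_lt_trans fk)// ltry.
  by rewrite lee_wpmul2r ?sup_modular_ge0// lee_fin ltW.
have sup_orl : sup_modular <= dual_norm X orl S.
  apply: ge_ereal_sup => _ [f [mf rf] <-].
  have dual0 : 0 <= dual_norm X orl S.
    apply: le_ereal_sup_tmp; exists `|S (cst 0%R)|%:E; last by rewrite lee_fin.
    exists (cst 0%R); [split; [exact: X0|]|exact: erefl].
    apply: (le_trans (orlicz_norm_le2 _)).
    (* The scale [1/2], admissible for the zero function, compensates the factor 2 between the
       norms. *)
    rewrite (le_trans (_ : _ <= 2%:E * (2^-1)%:E))//; last first.
      by rewrite -EFinM divff.
    rewrite lee_pmul2l ?lte_fin//; apply: ereal_inf_lbound; exists (2^-1)%R => //.
    split; first by rewrite invr_gt0.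
    rewrite (_ : (fun t => _) = cst 0%R) ?rho0//.
    by apply/funext => t; rewrite mul0r.
  apply: (lee_scale_gt1 dual0) => e e0.
  have [g [mg ge ->]] := singular_small_modular mf rf e0.
  have e1 : (0 < 1 + e)%R by lra.
  have eV : (0 < (1 + e)^-1)%R by rewrite invr_gt0.
  have Xg : X g.
    by apply: modular_space_fin; [exact: mg|exact: le_lt_trans ge (ltry _)].
  (* The Orlicz norm of [g] is at most [1 + rho g <= 1 + e], so [g / (1 + e)] lies in the Orlicz
     unit ball. *)
  rewrite -lee_pdivrMl// -EFinM -singularZ//.
  apply: le_ereal_sup_tmp; exists `|S (fun t => (1 + e)^-1 * g t)%R|%:E; last first.
    by rewrite lee_fin ler_norm.
  exists (fun t => (1 + e)^-1 * g t)%R; [split|exact: erefl].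
    exact: modular_spaceZ.
  apply: (le_trans (orlicz_normZ _ eV)).
  rewrite lee_pdivrMl// mule1 (le_trans (orlicz_norm_le1D _))//.
  by rewrite EFinD leeD2l.
have dual_orlE : dual_norm X orl S = sup_modular.
  by apply/eqP; rewrite eq_le sup_orl (le_trans orl_lux).
split => //.
  by apply/eqP; rewrite eq_le orl_lux dual_orlE lux_sup.
set A := (X in sup_or0 X).
(* An empty set gives 0 by convention; otherwise [f] or [-f] contributes a nonnegative quotient. *)
have A_ge0 : 0 <= sup_or0 A.
  rewrite /sup_or0; case: eqVneq => // /set0P[_ [f [Xf nf] _]].
  have [S0|S0] := leP 0%R (S f).
    apply: le_ereal_sup_tmp; exists (S f / fine (theta rho f))%:E.
      by exists f.
    by rewrite lee_fin divr_ge0// fine_ge0// ltW// theta_gt0.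
  have nf' : ~ order_continuous mu D X lux (fun t => -1 * f t)%R.
    apply: contra_not nf => -[Xnf h]; split => // u Xu uf.
    by apply: h => // n; apply: filterS (uf n) => t; rewrite mulN1r normrN.
  have Xnf := modular_spaceZ (-1) Xf.
  apply: le_ereal_sup_tmp.
  exists (S (fun t => -1 * f t)%R / fine (theta rho (fun t => -1 * f t)%R))%:E.
    by exists (fun t => -1 * f t)%R.
  rewrite lee_fin singularZ// divr_ge0//; first by lra.
  by rewrite fine_ge0// ltW// theta_gt0.
apply/eqP; rewrite eq_le; apply/andP; split.
  apply: ge_ereal_sup => _ [f [mf rf] <-].
  have Xf := modular_space_fin mf rf.
  have [Sf|Sf] := leP (S f) 0%R; first by rewrite (le_trans _ A_ge0)// lee_fin.
  (* A positive [S f] rules out order continuity, and finite modular gives [theta <= 1], so dividing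
     by [theta] can only increase [S f]. *)
  have nf : ~ order_continuous mu D X lux f.
    by move=> /S_oc Sf0; move: Sf; rewrite Sf0 ltxx.
  have t1 : theta rho f <= 1.
    apply: ereal_inf_lbound; exists 1%R; [split; [exact: ltr01|]|exact: erefl].
    by under eq_fun do rewrite divr1.
  have t0 := theta_gt0 Xf nf.
  have tfin : (theta rho f) \is a fin_num.
    by rewrite ge0_fin_numE ?theta_lty// ltW.
  have Af : A (S f / fine (theta rho f))%:E by exists f.
  rewrite /sup_or0 ifF; last by apply/eqP => A0; move: Af; rewrite A0.
  apply: le_ereal_sup_tmp; exists (S f / fine (theta rho f))%:E => //.
  rewrite lee_fin ler_pdivlMr ?fine_gt0 ?t0 ?theta_lty//.
  by rewrite ler_piMr ?(ltW Sf)// -lee_fin fineK.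
rewrite /sup_or0; case: eqVneq => _; first exact: sup_modular_ge0.
apply: ge_ereal_sup => _ [f [Xf nf] <-].
have t0 := theta_gt0 Xf nf.
have tfin : (theta rho f) \is a fin_num.
  by rewrite ge0_fin_numE ?theta_lty// ltW.
set th := fine (theta rho f).
have th0 : (0 < th)%R by rewrite fine_gt0// t0 theta_lty.
have thE : theta rho f = th%:E by rewrite fineK.
(* The modular may be infinite at the scale [theta] itself, so an admissible scale slightly above it
   is used. *)
apply: (lee_scale_gt1 sup_modular_ge0) => e e0.
have /ereal_inf_lt[_ [k [k0 fk] <-]] : theta rho f < (th * (1 + e))%:E.
  by rewrite thE lte_fin ltr_pMr//; lra.
rewrite lte_fin => ke.
rewrite mulrC EFinM lee_pdivrMl// muleA -EFinM.
apply: (@le_trans _ _ (k%:E * sup_modular)).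
  apply: le_trans (singular_le_scale Xf k0 fk).
  by rewrite lee_fin ler_norm.
by rewrite lee_wpmul2r ?sup_modular_ge0// lee_fin ltW.
Qed.

End singular.

Lemma singular_functional_norms (S : (T -> R) -> R) :
  singular_functional mu D X lux S \/ singular_functional mu D X orl S ->
  [/\ dual_norm X lux S = dual_norm X orl S,
      dual_norm X orl S =
        ereal_sup [set (S f)%:E | f in [set f | L f /\ rho f < +oo]] &
      ereal_sup [set (S f)%:E | f in [set f | L f /\ rho f < +oo]] =
        sup_or0 [set (S f / fine (theta rho f))%:E | f in
          X `\` order_continuous mu D X lux]].
Proof.
case=> -[[_ S_lin _] S_oc]; apply: singular_dual_norms => // f.
by move=> /order_continuous_orlicz; exact: S_oc.
Qed.

End orlicz_lorentz.

(** * The two concrete spaces *)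

Section function_space.
Context {R : realType}.
Implicit Types (gamma : \bar R) (w phi : R -> R).

Local Notation m := (@completed_lebesgue_measure R).

Lemma I_itv gamma : 0 < gamma -> I_ gamma =
  [set` Interval (BLeft 0%R) (if gamma is r%:E then BLeft r else +oo%O)].
Proof.
case: gamma => [r _| _|//]; apply/seteqP; split=> t /=; rewrite in_itv/= ?andbT.
- by move=> [-> /=]; rewrite lte_fin.
- by move=> /andP[t0 tr]; split; rewrite ?lte_fin.
- by case.
- by move=> t0; split; rewrite ?ltry.
Qed.

Lemma completed_lebesgue_measure_I gamma : 0 < gamma -> m (I_ gamma) = gamma.
Proof.
move=> g0; rewrite (I_itv g0).
have -> A : m (A : set (lebesgueType R)) = lebesgue_measure (A : set R) by [].
rewrite lebesgue_measure_itv/=; case: gamma g0 => [r| |//].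
  by move=> r0; rewrite r0 sube0.
by rewrite ltry sube0.
Qed.

Lemma measurable_lebesgueType (A : set R) : measurable A ->
  measurable (A : set (lebesgueType R)).
Proof. by move=> mA; exact: sub_caratheodory. Qed.

(** Monotonicity is known off 0 only: measurability is reduced to the interval open at 0, where
    superlevel sets are intervals. *)
Lemma measurable_weight gamma w : 0 < gamma -> function_weight gamma w ->
  measurable_fun (I_ gamma) w.
Proof.
move=> g0 [_ w_anti _ _]; have Ib := I_itv g0; set b := (X in Interval _ X) in Ib.
rewrite Ib; apply/measurable_fun_itv_obnd_cbndP.
move=> mI; apply: (measurability _ (RGenOInfty.measurableE R)) => //.
move=> _ [_ [c ->] <-]; apply: is_interval_measurable.
have sub0 : [set` Interval (BRight 0%R) b] `<=` I_ gamma.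
  by rewrite Ib; apply: subset_itvr; rewrite bnd_simp.
move=> x y [x0 xc] [y0 yc] z /andP[xz zy].
have z0 : [set` Interval (BRight 0%R) b] z.
  by apply: (interval_is_interval x0 y0); rewrite xz.
split => //; move: yc; rewrite /= !in_itv/= !andbT => /lt_le_trans; apply.
apply: w_anti => //; last exact: sub0.
by move: z0; rewrite /= itv_boundlr => /andP[].
Qed.

Lemma I_exhaustion gamma : 0 < gamma -> exists a : nat -> R,
  [/\ forall n, I_ gamma (a n), {homo a : n k / (n <= k)%N >-> (n <= k)%R} &
      forall t, I_ gamma t -> exists n, (t <= a n)%R].
Proof.
case: gamma => [r| _|//]; last first.
  exists (fun n => n%:R); split=> [n|n k nk|t [t0 _]].
  - by split; rewrite ?ltry.
  - by rewrite ler_nat.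
  - by exists (Num.bound t); apply: ltW; rewrite archi_boundP.
(* The points stay strictly below [gamma], where the weight has a finite primitive; [t] is passed
   once [n.+1] exceeds [r / (r - t)]. *)
rewrite lte_fin => r0; exists (fun n => r * (1 - n.+1%:R^-1))%R; split.
- move=> n; have n0 : (0 < n.+1%:R^-1 :> R)%R by rewrite invr_gt0.
  have n1 : (n.+1%:R^-1 <= 1 :> R)%R by rewrite invf_le1// ler1n.
  split; first by rewrite mulr_ge0 ?subr_ge0// ltW.
  by rewrite lte_fin gtr_pMr// ltrBlDr ltrDl.
- move=> n k nk; rewrite ler_pM2l// lerD2l lerN2 lef_pV2 ?posrE//.
  by rewrite ler_nat.
- move=> t [t0]; rewrite lte_fin => tr.
  have rt : (0 < r / (r - t))%R by rewrite divr_gt0// subr_gt0.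
  exists (Num.bound (r / (r - t))).
  have := archi_boundP (ltW rt); set n := Num.bound _ => nb.
  have n0 : (0 < n.+1%:R :> R)%R by [].
  have nb' : (r / (r - t) < n.+1%:R)%R by rewrite (lt_le_trans nb)// ler_nat.
  rewrite mulrBr mulr1 lerBrDr -lerBrDl ler_pdivrMr//.
  by move: nb'; rewrite ltr_pdivrMr ?subr_gt0// mulrC => /ltW.
Qed.

Lemma singular_function_norms gamma phi w (S : (lebesgueType R -> R) -> R) :
  orlicz_function phi -> 0 < gamma -> function_weight gamma w ->
  singular_Lambda gamma phi w (Lambda_lux gamma phi w) S \/
  singular_Lambda gamma phi w (Lambda_orl gamma phi w) S ->
  [/\ dual_norm (Lambda gamma phi w) (Lambda_lux gamma phi w) S =
      dual_norm (Lambda gamma phi w) (Lambda_orl gamma phi w) S,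
      dual_norm (Lambda gamma phi w) (Lambda_orl gamma phi w) S =
      ereal_sup [set (S f)%:E | f in
        [set f | L0 gamma f /\ rho gamma phi w f < +oo]] &
      ereal_sup [set (S f)%:E | f in
        [set f | L0 gamma f /\ rho gamma phi w f < +oo]] =
      sup_or0 [set (S f / fine (theta (rho gamma phi w) f))%:E | f in
        Lambda gamma phi w `\` Lambda_a gamma phi w]].
Proof.
move=> hphi g0 hw; have [w_gt0 _ w_int w_infty] := hw.
have [a [aI a_le a_cover]] := I_exhaustion g0.
have mI : measurable (I_ gamma) by rewrite I_itv//; exact: measurable_itv.
have a0 n : (0 <= a n)%R by case: (aI n).
have D_E n : I_ gamma `&` [set t | (t <= a n)%R] = `[0%R, a n]%classic.
  apply/seteqP; split=> t /=; rewrite in_itv/=; first by move=> [[-> _] ->].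
  move=> /andP[t0 ta]; split=> //; split => //.
  by case: (aI n) => _; apply: le_lt_trans; rewrite lee_fin.
have m_itv n : m (`[0%R, a n]%classic : set (lebesgueType R)) = (a n)%:E.
  have -> : m (`[0%R, a n]%classic : set (lebesgueType R)) =
    lebesgue_measure (`[0%R, a n]%classic : set R) by [].
  rewrite lebesgue_measure_itv/= lte_fin; case: ltP; first by rewrite sube0.
  by move=> h; congr EFin; apply/eqP; rewrite eq_le h a0.
apply: (@singular_functional_norms R _ (lebesgueType R) m
  (I_ gamma : set (lebesgueType R)) _ _ _ (@lebesgue_measure R) (I_ gamma) id w
  _ _ _ _ phi hphi _ _ _ (fun n => I_ gamma `&` [set t | (t <= a n)%R])).
- exact: measurable_lebesgueType.
- exact: mI.
- exact: measurable_id.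
- exact: measurable_weight.
- exact: w_gt0.
- rewrite /= completed_lebesgue_measure_I// => gy.
  by rewrite (_ : I_ gamma = `[0%R, +oo[%classic) ?w_infty// I_itv// gy.
- by move=> t [].
- exists [set 0%R]; split; [exact: measurable_set1|exact: lebesgue_measure_set1|].
  move=> t /= nt; apply: contrapT => t0; apply: nt => -[tge0 _].
  exists t; last by move=> A _ _ /ltW.
  by rewrite lt_neqAle tge0 andbT eq_sym; apply/eqP.
- by move=> n; apply: measurable_lebesgueType; rewrite D_E.
- by move=> n t [].
- by move=> n k nk t [It ta]; split => //; exact: le_trans (a_le _ _ nk).
- by move=> t It; have [n tn] := a_cover _ It; exists n.
- move=> n; rewrite D_E; apply: le_lt_trans (w_int _ (aI n)).
  have sub t : `[0%R, a n]%classic t -> I_ gamma t by rewrite -D_E => -[].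
  apply: ge0_subset_integral => //.
  + apply: emeasurable_fun_infty_o => //.
  + apply/measurable_EFinP; apply: (measurable_funS mI) => //.
    exact: measurable_weight.
  + by move=> t /sub It; rewrite lee_fin ltW// w_gt0.
  + move=> t [[t0 _] ta]; rewrite /= in_itv/= t0 /= -lee_fin -m_itv.
    exact: ltW.
Qed.

End function_space.

Section sequence_space.
Context {R : realType}.
Implicit Types (x w : nat -> R) (phi : R -> R).

Local Notation count := (@counting nat R).
Local Notation nat_R := (fun i : nat => i%:R : R).

(** Counting masses are integers or infinite. This matches the strict inequality in the definition
    for sequences with the large one of the general rearrangement. *)
Lemma counting_lt_nat (A : set nat) n :
  (count A < n.+1%:R%:E) = (count A <= n%:R%:E).
Proof.
rewrite /counting; case: ifP => _; last by rewrite !leye_eq.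
by rewrite lte_fin lee_fin ltr_nat ler_nat ltnS.
Qed.

Lemma counting_II n : count `I_n = n%:R%:E.
Proof.
rewrite /counting asboolT; last exact: finite_II.
by rewrite (@card_fset_set _ _ n).
Qed.

Lemma rearr_seqE x i : rearr_seq x i = rearr count setT nat_R x i.
Proof.
have distrE l : (distr_seq x l < i.+1%:R%:E) =
    (level_mass count setT x l <= i%:R%:E).
  rewrite /distr_seq counting_lt_nat; congr (count _ <= _).
  by apply/seteqP; split=> k //= [].
by congr ereal_inf; apply/seteqP; split=> _ [l [l0 xl] <-]; exists l => //;
  split => //; rewrite ?distrE// -distrE.
Qed.

Lemma alpha_seqE w (Phi : R -> \bar R) x : (forall i, 0 < w i)%R ->
  (forall u, (0 <= u)%R -> 0 <= Phi u) ->
  alpha_seq w Phi x = modular count setT count setT nat_R w Phi x.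
Proof.
move=> w_gt0 Phi_ge0; rewrite /modular ge0_integral_count.
  by apply: eq_eseriesr => i _; rewrite rearr_seqE.
by move=> i; apply: modular_integrand_ge0.
Qed.

Lemma pairing_seqE w x y : (forall i, 0 < w i)%R ->
  pairing_seq w x y = pairing count setT count setT nat_R w x y.
Proof.
move=> w_gt0; rewrite /pairing ge0_integral_count.
  by apply: eq_eseriesr => i _; rewrite !rearr_seqE.
by move=> i; apply: pairing_integrand_ge0.
Qed.

Lemma singular_sequence_norms phi w (S : (nat -> R) -> R) :
  orlicz_function phi -> sequence_weight w ->
  singular_lambda phi w (lambda_lux phi w) S \/
  singular_lambda phi w (lambda_orl phi w) S ->
  [/\ dual_norm (lambda phi w) (lambda_lux phi w) S =
      dual_norm (lambda phi w) (lambda_orl phi w) S,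
      dual_norm (lambda phi w) (lambda_orl phi w) S =
      ereal_sup [set (S x)%:E | x in [set x | alpha phi w x < +oo]] &
      ereal_sup [set (S x)%:E | x in [set x | alpha phi w x < +oo]] =
      sup_or0 [set (S x / fine (theta (alpha phi w) x))%:E | x in
        lambda phi w `\` lambda_a phi w]].
Proof.
move=> hphi [w_gt0 w_anti w_infty].
have mT (A : set nat) : measurable A by [].
have mfT (f : nat -> R) (A : set nat) : measurable_fun A f by move=> *; exact: mT.
have alphaE : alpha phi w = modular count setT count setT nat_R w (EFin \o phi).
  apply/funext => x; apply: alpha_seqE => // u u0.
  by rewrite lee_fin orlicz_ge0.
have alpha_starE : alpha_seq w (complementary phi) =
    modular count setT count setT nat_R w (complementary phi).
  apply/funext => x; apply: alpha_seqE => // u u0; exact: complementary_ge0.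
have pairingE : pairing_seq w = pairing count setT count setT nat_R w.
  by apply/funext => x; apply/funext => y; exact: pairing_seqE.
have LE : setT = [set f : nat -> R | measurable_fun setT f].
  by apply/seteqP; split => // f _; exact: mfT.
have supE : [set x | alpha phi w x < +oo] =
    [set x | [set f : nat -> R | measurable_fun setT f] x /\ alpha phi w x < +oo].
  by apply/seteqP; split => [x|x []].
rewrite supE /singular_lambda /lambda_a /lambda /lambda_lux /lambda_orl.
rewrite alphaE alpha_starE pairingE LE.
apply: (@singular_functional_norms R _ nat count setT _ _ _ count setT nat_R w
  _ _ _ _ phi hphi _ _ _ (fun n => `I_n)) => //.
- by move=> _; rewrite ge0_integral_count// => i; rewrite lee_fin ltW.
- apply: aeW => i _; exists 1%R => // A _ _.
  rewrite (counting_lt_nat _ 0) => /le_trans; apply.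
  by rewrite lee_fin.
- by move=> n k nk i /= ni; exact: leq_trans nk.
- by move=> i _; exists i.+1 => /=.
- move=> n; rewrite setTI.
  have -> : [set j | (j%:R%:E : \bar R) < count `I_n] = `I_n.
    by rewrite counting_II; apply/seteqP; split=> j /=; rewrite lte_fin ltr_nat.
  (* The sum of the first [n] weights is at most [n] times the largest one, [w 0]. *)
  apply: (@le_lt_trans _ _ (\int[count]_(i in `I_n) (w 0)%:E)).
    apply: ge0_le_integral => //.
    + by move=> i _; rewrite lee_fin ltW.
    + by move=> i _; rewrite lee_fin; exact: w_anti.
  by rewrite integral_cst//= counting_II -EFinM ltry.
Qed.

End sequence_space.

Theorem theorem2p2 (R : realType) (phi : R -> R) (hphi : orlicz_function phi) :
  (forall (gamma : \bar R) (w : R -> R) (S : (lebesgueType R -> R) -> R),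
     0 < gamma ->
     function_weight gamma w ->
     singular_Lambda gamma phi w (Lambda_lux gamma phi w) S \/
     singular_Lambda gamma phi w (Lambda_orl gamma phi w) S ->
     [/\ dual_norm (Lambda gamma phi w) (Lambda_lux gamma phi w) S =
         dual_norm (Lambda gamma phi w) (Lambda_orl gamma phi w) S,
         dual_norm (Lambda gamma phi w) (Lambda_orl gamma phi w) S =
         ereal_sup [set (S f)%:E | f in
           [set f | L0 gamma f /\ rho gamma phi w f < +oo]] &
         ereal_sup [set (S f)%:E | f in
           [set f | L0 gamma f /\ rho gamma phi w f < +oo]] =
         sup_or0 [set (S f / fine (theta (rho gamma phi w) f))%:E | f in
           Lambda gamma phi w `\` Lambda_a gamma phi w]]) /\
  (forall (w : nat -> R) (S : (nat -> R) -> R),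
     sequence_weight w ->
     singular_lambda phi w (lambda_lux phi w) S \/
     singular_lambda phi w (lambda_orl phi w) S ->
     [/\ dual_norm (lambda phi w) (lambda_lux phi w) S =
         dual_norm (lambda phi w) (lambda_orl phi w) S,
         dual_norm (lambda phi w) (lambda_orl phi w) S =
         ereal_sup [set (S x)%:E | x in [set x | alpha phi w x < +oo]] &
         ereal_sup [set (S x)%:E | x in [set x | alpha phi w x < +oo]] =
         sup_or0 [set (S x / fine (theta (alpha phi w) x))%:E | x in
           lambda phi w `\` lambda_a phi w]]).
Proof.
split=> [gamma w S|w S]; first exact: singular_function_norms.
exact: singular_sequence_norms.
Qed.
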